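(* Let $a\in\mathbb C$ with $ia\notin(-\infty,-1]\cup[1,\infty)$. Then the system of vector functions $$\left\{\begin{pmatrix}e^{anx}\sin nx\\ n\,e^{anx}(\sin nx+i\cos nx)\end{pmatrix}\right\}_{n\in\mathbb Z\setminus\{0\}}$$ is complete and minimal in $L^2([0,\pi];\mathbb C^2)$.
   Context: A system in a Hilbert space is complete if its closed linear span is the whole space, and minimal if no element of it lies in the closed linear span of the others. *)

(* Defs.v *)
From mathcomp Require Import all_boot all_order all_algebra.
From mathcomp Require Import all_classical all_reals all_analysis.
From mathcomp Require Import complex.

Set Implicit Arguments.
Unset Strict Implicit.
Unset Printing Implicit Defensive.

Import Order.TTheory GRing.Theory Num.Theory.
Import numFieldNormedType.Exports.

Local Open Scope classical_set_scope.
Local Open Scope ring_scope.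
Local Open Scope complex_scope.

(* A Hilbert space is presented here by representatives: a set L of vectors of
   an ambient space V together with its norm N, two vectors of L at distance 0
   being identified. All notions below are invariant under this
   identification. *)
Section systems.
Context {R : realType} {K : nzRingType} {V : lmodType K} {I : choiceType}.
Variables (L : set V) (N : V -> \bar R).

Definition lin_span (v : I -> V) (D : set I) : set V :=
  [set g | exists (s : seq I) (c : I -> K),
     [set` s] `<=` D /\ g = \sum_(i <- s) c i *: v i].

Definition closed_lin_span (v : I -> V) (D : set I) : set V :=
  [set f | L f /\ forall e : R, 0 < e ->
     exists2 g, lin_span v D g & (N (f - g) < e%:E)%E].

Definition system_in (v : I -> V) (D : set I) : Prop :=
  forall i, D i -> L (v i).

Definition complete_system (v : I -> V) (D : set I) : Prop :=
  closed_lin_span v D = L.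

Definition minimal_system (v : I -> V) (D : set I) : Prop :=
  forall i, D i -> ~ closed_lin_span v (D `\ i) (v i).

End systems.

Section L2_0pi.
Context {R : realType}.
Implicit Types (z : R[i]) (f : R -> 'cV[R[i]]_2).

Definition sqnormC2 (w : 'cV[R[i]]_2) : R :=
  \sum_(j < 2) (complex.Re (w j ord0) ^+ 2 + complex.Im (w j ord0) ^+ 2).

(* Only the values on [0, pi] matter: functions are total on R, and two
   functions agreeing almost everywhere on [0, pi] are at distance 0. *)
Definition L2norm f : \bar R :=
  ((\int[lebesgue_measure]_(x in `[0%R, pi : R]) (sqnormC2 (f x))%:E) `^ 2^-1%R)%E.

Definition L2 : set (R -> 'cV[R[i]]_2) :=
  [set f : R -> 'cV[R[i]]_2 | (forall j, measurable_fun `[0, pi : R] (fun x : R => complex.Re (f x j ord0)))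
        /\ (forall j, measurable_fun `[0, pi : R] (fun x : R => complex.Im (f x j ord0)))
        /\ (L2norm f < +oo)%E].

Definition expC z : R[i] :=
  (expR (complex.Re z))%:C * (cos (complex.Im z) +i* sin (complex.Im z)).

Definition phi (a : R[i]) (n : int) (x : R) : 'cV[R[i]]_2 :=
  let nx := n%:~R * x in
  \col_(j < 2)
    if j == ord0 then expC (a * nx%:C) * (sin nx)%:C
    else n%:~R * expC (a * nx%:C) * ((sin nx)%:C + 'i%C * (cos nx)%:C).

End L2_0pi.

(* Main.v *)
Require Import Defs.
From mathcomp Require Import all_boot all_order all_algebra.
From mathcomp Require Import all_classical all_reals all_analysis.
From mathcomp Require Import complex.
From mathcomp Require Import measurable_realfun.
From mathcomp Require Import ring lra zify.

Set Implicit Arguments.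
Unset Strict Implicit.
Unset Printing Implicit Defensive.

Import Order.TTheory GRing.Theory Num.Theory.
Import numFieldNormedType.Exports.

Local Open Scope classical_set_scope.
Local Open Scope ring_scope.
Local Open Scope complex_scope.

(** Put [u = a + i] and [w = a - i].  Up to constants, the [n]-th vector is
    [(e^(unx) - e^(wnx), n e^(wnx))].  Since [pi u - pi w = 2 i pi], the image
    under the exponential of the segments [[0, pi u]] and [[0, pi w]] is a closed
    curve, and the hypothesis on [a] ensures that this curve is a Jordan
    curve around [0]: there is a direction [d = 1 + i y] such that the two
    segments lie on different sides of the line spanned by [d] (lemmas
    [transversal_direction] and [curve_separation]).

    Minimality.  The entire function [(e^(pi u z) - e^(pi w z)) / (z - n)]
    vanishes at all integers but [n].  Integrating by parts, it can be written
    as the pairing of the vector of index [z] with an explicit bounded function;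
    this gives a biorthogonal system.  Concretely, the pairing of the [m]-th
    vector is the derivative of an elementary function, whose increment over
    [[0, pi]] is [0] for [m != n] and [2 i pi] for [m = n] (lemma
    [phi_notin_closed_span]).

    Completeness.  A Laurent polynomial [q] on the curve is sent by [Theta] to
    a finite combination of the vectors: one removes the mean of [q], integrates
    it along the curve to get the first component, and evaluates it on the
    second branch to get the second one.  So it is enough to approximate enough
    functions on the curve by Laurent polynomials.  The approximation is
    obtained without contour integrals.  For a point [sg] of the curve, the
    function [k(s) = 2 e^(sg/2) sinh ((s - sg) / 2)] has a square which is a
    Laurent polynomial in [e^s].  That square, perturbed by moving its zero off
    the curve in the direction [d], has approximate inverse square roots among
    the Laurent polynomials: this is clear far from the curve, and Newton's
    iteration carries the property over to all positive distances
    ([laurent_sqrt]).  In the limit one gets Laurent polynomials whose squares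
    approach [k^2].  They approach [k] or [- k], with a constant sign on each arc
    of the curve without [sg]; since [k] takes opposite values at the two ends
    [pi u] and [pi w], where Laurent polynomials take the same value, the sign
    has to change at [sg] ([laurent_sign]).  The uniform limits are therefore
    functions with a corner at [sg], which are not analytic.

    Second differences of these functions with respect to [sg] on the first
    branch produce, in the closed span, the vectors [(1_J, 0)] for all intervals
    [J], hence all vectors [(f, 0)] ([clos_Theta_step], [clos_fst]).  First
    differences on the second branch produce the vectors
    [(0, 1_J e^(-wx/2))], hence all vectors [(0, g)] ([clos_snd]).  The passage
    from indicators of intervals to square integrable functions is the usual
    argument with Dynkin systems and simple functions ([clos_complex]). *)

(** * The modulus and the exponential of complex numbers *)

Notation cabs := ComplexField.Normc.normc.
Notation Cre := (@complex.Re _).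
Notation Cim := (@complex.Im _).

Section complex_modulus.
Context {R : realType}.
Implicit Types (z w : R[i]) (x : R).

Lemma cabs0 : cabs (0 : R[i]) = 0. Proof. exact: ComplexField.Normc.normc0. Qed.
Lemma cabs1 : cabs (1 : R[i]) = 1. Proof. exact: ComplexField.Normc.normc1. Qed.
Lemma cabsM z w : cabs (z * w) = cabs z * cabs w.
Proof. exact: ComplexField.Normc.normcM. Qed.
Lemma cabsV z : cabs z^-1 = (cabs z)^-1.
Proof. exact: ComplexField.Normc.normcV. Qed.
Lemma cabsN z : cabs (- z) = cabs z. Proof. exact: normcN. Qed.
Lemma cabsD z w : cabs (z + w) <= cabs z + cabs w. Proof. exact: le_normcD. Qed.
Lemma cabsB z w : cabs (z - w) <= cabs z + cabs w.
Proof. by rewrite -[cabs w]cabsN; exact: cabsD. Qed.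
Lemma cabs_distC z w : cabs (z - w) = cabs (w - z).
Proof. by rewrite -cabsN opprB. Qed.
Lemma cabsX z n : cabs (z ^+ n) = cabs z ^+ n.
Proof.
elim: n => [|n ih]; first by rewrite !expr0 cabs1.
by rewrite !exprS cabsM ih.
Qed.
Lemma sqr_cabs z : cabs z ^+ 2 = Cre z ^+ 2 + Cim z ^+ 2.
Proof. by case: z => x y /=; rewrite sqr_sqrtr// addr_ge0// sqr_ge0. Qed.
Lemma cabs_ge0 z : 0 <= cabs z. Proof. by case: z => x y; exact: sqrtr_ge0. Qed.
Lemma cabs_eq0 z : (cabs z == 0) = (z == 0).
Proof.
by apply/eqP/eqP => [/ComplexField.Normc.eq0_normc//|->]; exact: cabs0.
Qed.
Lemma cabs_gt0 z : (0 < cabs z) = (z != 0).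
Proof. by rewrite lt_def cabs_ge0 cabs_eq0 andbT. Qed.
Lemma normr_Re_le z : `|Cre z| <= cabs z.
Proof.
rewrite -(@ler_pXn2r _ 2)// ?nnegrE ?cabs_ge0//.
by rewrite sqr_cabs real_normK ?num_real// lerDl sqr_ge0.
Qed.
Lemma normr_Im_le z : `|Cim z| <= cabs z.
Proof.
rewrite -(@ler_pXn2r _ 2)// ?nnegrE ?cabs_ge0//.
by rewrite sqr_cabs real_normK ?num_real// lerDr sqr_ge0.
Qed.
Lemma cabs_real x : cabs x%:C = `|x|.
Proof. by rewrite /= expr0n/= addr0 sqrtr_sqr. Qed.
Lemma cabs_i : cabs ('i%C : R[i]) = 1.
Proof. by rewrite /= expr0n/= add0r expr1n sqrtr1. Qed.
Lemma cabs_nat n : cabs (n%:R : R[i]) = n%:R.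
Proof. by rewrite -[n%:R in LHS](rmorph_nat (real_complex R)) cabs_real normr_nat. Qed.
Lemma cabs_le_ReIm z : cabs z <= `|Cre z| + `|Cim z|.
Proof.
rewrite {1}[z]complexE (le_trans (cabsD _ _))// cabsM cabs_i !cabs_real mul1r//.
Qed.

Lemma ReD z w : Cre (z + w) = Cre z + Cre w.
Proof. by case: z; case: w. Qed.
Lemma ImD z w : Cim (z + w) = Cim z + Cim w.
Proof. by case: z; case: w. Qed.
Lemma ReN z : Cre (- z) = - Cre z. Proof. by case: z. Qed.
Lemma ImN z : Cim (- z) = - Cim z. Proof. by case: z. Qed.
Lemma ReM z w : Cre (z * w) =
  Cre z * Cre w - Cim z * Cim w.
Proof. by case: z; case: w. Qed.
Lemma ImM z w : Cim (z * w) =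
  Cre z * Cim w + Cim z * Cre w.
Proof. by case: z; case: w. Qed.

End complex_modulus.

Section complex_exponential.
Context {R : realType}.
Implicit Types (z w : R[i]) (x : R).

Lemma expC0 : expC 0 = 1 :> R[i].
Proof. by rewrite /expC /= expR0 cos0 sin0 mul1r. Qed.

Lemma expCD z w : expC (z + w) = expC z * expC w.
Proof.
rewrite /expC ReD ImD expRD cosD sinD.
set p := expR _; set q := expR _.
apply/eqP; rewrite eq_complex !(ReM, ImM)/=.
by apply/andP; split; apply/eqP; ring.
Qed.

Lemma expC_neq0 z : expC z != 0.
Proof.
apply/negP => /eqP h; have := expCD z (- z).
by rewrite subrr expC0 h mul0r => /eqP; rewrite oner_eq0.
Qed.

Lemma expCN z : expC (- z) = (expC z)^-1.
Proof.
apply: (mulfI (expC_neq0 z)).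
by rewrite -expCD subrr expC0 mulfV// expC_neq0.
Qed.

Lemma cabs_expC z : cabs (expC z) = expR (Cre z).
Proof.
rewrite /expC cabsM cabs_real ger0_norm ?expR_ge0//=.
by rewrite cos2Dsin2 sqrtr1 mulr1.
Qed.

Lemma expC_natM n z : expC (n%:R * z) = expC z ^+ n.
Proof.
elim: n => [|n ih]; first by rewrite mul0r expC0 expr0.
by rewrite exprS -ih -expCD; congr expC; rewrite mulrS; ring.
Qed.

Lemma expC_intM (n : int) z w : expC z = expC w ->
  expC (n%:~R * z) = expC (n%:~R * w).
Proof.
move=> zw; case: n => n; first by rewrite -!pmulrn !expC_natM zw.
by rewrite NegzE !mulrNz !mulNr !expCN -!pmulrn !expC_natM zw.
Qed.

Lemma expC_ipi : expC ('i%C * pi%:C) = -1 :> R[i].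
Proof.
rewrite /expC/= !(mul0r, mulr0, mul1r, subr0, addr0, add0r, expR0) cospi sinpi.
by apply/eqP; rewrite eq_complex/= !(mul0r, mulr0, mul1r, subr0, addr0, oppr0, expR0) !eqxx.
Qed.

(** The period of [expC] is [2 i pi]; the bound on the imaginary part leaves
    only the multiples [0] and [+- 2 i pi] of it. *)
Lemma expC_eq1 z : expC z = 1 -> `|Cim z| <= pi *+ 2 ->
  Cre z = 0 /\ (Cim z = 0 \/ `|Cim z| = pi *+ 2).
Proof.
move=> e1 bd.
have re0 : Cre z = 0.
  apply: (@expR_inj R); rewrite expR0 -cabs_expC e1; exact: cabs1.
split=> //; move: e1; rewrite /expC re0 expR0.
move=> /(congr1 Cre) /=; rewrite mul0r subr0 mul1r => c1.
have {}c1 : cos `|Cim z| = 1.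
  by case: (ger0P (Cim z)) => _; rewrite ?cosN.
have [le|gt] := leP `|Cim z| pi.
  left; apply/eqP; rewrite -normr_eq0; apply/eqP.
  by apply: cos_inj; rewrite ?in_itv/= ?lexx ?pi_ge0 ?normr_ge0 ?cos0.
right; apply/eqP; rewrite eq_sym -subr_eq0; apply/eqP.
apply: cos_inj; rewrite ?in_itv/= ?lexx ?pi_ge0 ?cos0 ?subr_ge0 ?bd//=.
  by rewrite mulr2n; lra.
by rewrite -cosN opprB -(cosD2pi (_ - _)) subrK.
Qed.

End complex_exponential.

(** * Complex-valued functions of a real variable *)

Section complex_valued_functions.
Context {R : realType}.
Implicit Types (f g : R -> R[i]) (x : R).

Definition ccont f := continuous (Cre \o f) /\ continuous (Cim \o f).

Definition cder f (df : R[i]) x :=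
  is_derive x 1 (Cre \o f) (Cre df) /\
  is_derive x 1 (Cim \o f) (Cim df).

Lemma cder_cst (c : R[i]) x : cder (fun=> c) 0 x.
Proof. by split => /=; rewrite /comp; exact: is_derive_cst. Qed.

Lemma cder_id x : cder (fun x => x%:C) 1 x.
Proof.
by split => /=; rewrite /comp/=; [exact: is_derive_id|exact: is_derive_cst].
Qed.

Lemma cderD f g df dg x : cder f df x -> cder g dg x ->
  cder (fun x => f x + g x) (df + dg) x.
Proof.
move=> [f1 f2] [g1 g2]; split; rewrite ?ReD ?ImD.
  have -> : Cre \o (fun x => f x + g x) = (Cre \o f) + (Cre \o g).
    by apply/funext => t; rewrite /comp ReD.
  exact: is_deriveD.
have -> : Cim \o (fun x => f x + g x) = (Cim \o f) + (Cim \o g).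
  by apply/funext => t; rewrite /comp ImD.
exact: is_deriveD.
Qed.

Lemma cderM f g df dg x : cder f df x -> cder g dg x ->
  cder (fun x => f x * g x) (df * g x + f x * dg) x.
Proof.
move=> [f1 f2] [g1 g2]; split.
  have -> : Cre \o (fun x => f x * g x) =
    (Cre \o f) * (Cre \o g) - (Cim \o f) * (Cim \o g).
    by apply/funext => t; rewrite /comp ReM.
  apply: is_derive_eq; rewrite ReD !ReM /GRing.scale/=; ring.
have -> : Cim \o (fun x => f x * g x) =
    (Cre \o f) * (Cim \o g) + (Cim \o f) * (Cre \o g).
  by apply/funext => t; rewrite /comp ImM.
apply: is_derive_eq; rewrite ImD !ImM /GRing.scale/=; ring.
Qed.

Lemma cderZ (c : R[i]) f df x : cder f df x -> cder (fun x => c * f x) (c * df) x.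
Proof.
by move=> h; have := cderM (cder_cst c x) h; rewrite mul0r add0r.
Qed.

Lemma cderB f g df dg x : cder f df x -> cder g dg x ->
  cder (fun x => f x - g x) (df - dg) x.
Proof.
move=> hf hg; have := cderD hf (cderZ (-1) hg); rewrite mulN1r.
by under eq_fun do rewrite mulN1r.
Qed.

Lemma cder_expC (z : R[i]) x :
  cder (fun x => expC (z * x%:C)) (z * expC (z * x%:C)) x.
Proof.
rewrite /expC; case: z => p q; split => /=; rewrite /comp/=.
  under eq_fun do rewrite !mul0r !mulr0 subr0 add0r subr0.
  rewrite !mul0r !mulr0 !subr0 !add0r !addr0.
  by apply: is_derive_eq; rewrite /GRing.scale/=; ring.
under eq_fun do rewrite !mul0r !mulr0 subr0 add0r addr0.
rewrite !mul0r !mulr0 !subr0 !add0r !addr0.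
by apply: is_derive_eq; rewrite /GRing.scale/=; ring.
Qed.

Lemma cder_ccont f df : (forall x, cder f (df x) x) -> ccont f.
Proof.
move=> h; split => x; have [h1 h2] := h x; apply: differentiable_continuous;
  apply/derivable1_diffP; exact: ex_derive.
Qed.

Lemma ccont_cst (c : R[i]) : ccont (fun=> c).
Proof. apply: cder_ccont => x; exact: cder_cst. Qed.

Lemma ccont_expC (z : R[i]) : ccont (fun x => expC (z * x%:C)).
Proof. apply: cder_ccont => x; exact: cder_expC. Qed.

Lemma ccontD f g : ccont f -> ccont g -> ccont (fun x => f x + g x).
Proof.
move=> [f1 f2] [g1 g2]; split => x.
  have -> : Cre \o (fun x => f x + g x) = (Cre \o f) \+ (Cre \o g).
    by apply/funext => t; rewrite /comp ReD.
  by apply: cvgD; [exact: f1|exact: g1].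
have -> : Cim \o (fun x => f x + g x) = (Cim \o f) \+ (Cim \o g).
  by apply/funext => t; rewrite /comp ImD.
by apply: cvgD; [exact: f2|exact: g2].
Qed.

Lemma ccontM f g : ccont f -> ccont g -> ccont (fun x => f x * g x).
Proof.
move=> [f1 f2] [g1 g2]; split => x.
  have -> : Cre \o (fun x => f x * g x) =
    (Cre \o f) \* (Cre \o g) \- (Cim \o f) \* (Cim \o g).
    by apply/funext => t; rewrite /comp ReM.
  by apply: cvgB; apply: cvgM; [exact: f1|exact: g1|exact: f2|exact: g2].
have -> : Cim \o (fun x => f x * g x) =
    (Cre \o f) \* (Cim \o g) \+ (Cim \o f) \* (Cre \o g).
  by apply/funext => t; rewrite /comp ImM.
by apply: cvgD; apply: cvgM; [exact: f1|exact: g2|exact: f2|exact: g1].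
Qed.

Lemma ccont_cabs f : ccont f -> continuous (fun x => cabs (f x)).
Proof.
move=> [f1 f2] x.
have -> : (fun x => cabs (f x)) = Num.sqrt \o (fun x =>
    (Cre \o f) x * (Cre \o f) x + (Cim \o f) x * (Cim \o f) x).
  by apply/funext => t /=; case: (f t) => p q /=; rewrite !expr2.
apply: continuous_comp; last exact: sqrt_continuous.
by apply: cvgD; apply: cvgM; [exact: f1|exact: f1|exact: f2|exact: f2].
Qed.

(** The two components are estimated separately, whence the factor [2]. *)
Lemma cabs_increment_le f df (a b M : R) : a <= b ->
  (forall x, cder f (df x) x) -> (forall x, a < x < b -> cabs (df x) <= M) ->
  cabs (f b - f a) <= 2 * M * (b - a).
Proof.
move=> ab hf hM; move: ab; rewrite le_eqVlt => /orP[/eqP->|ab].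
  by rewrite !subrr cabs0 mulr0.
have [c1 c2] := cder_ccont hf.
have [x xab e1] := MVT ab (fun x _ => (hf x).1) (continuous_subspaceT c1).
have [y yab e2] := MVT ab (fun x _ => (hf x).2) (continuous_subspaceT c2).
apply: (le_trans (cabs_le_ReIm _)).
rewrite !(ReD, ImD, ReN, ImN); move: e1 e2; rewrite /= => -> ->.
have ba0 : 0 <= b - a by rewrite subr_ge0 ltW.
rewrite !normrM (ger0_norm ba0) -mulrDl; apply: ler_wpM2r => //.
rewrite mulr2n mulrDl !mul1r lerD//.
  by rewrite (le_trans (normr_Re_le _))// hM// -?in_itv.
by rewrite (le_trans (normr_Im_le _))// hM// -?in_itv.
Qed.

Lemma ccont_bounded f (a b : R) : ccont f ->
  exists2 M, 0 < M & forall x, a <= x <= b -> cabs (f x) <= M.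
Proof.
move=> /ccont_cabs cf; have [ab|ba] := leP a b; last first.
  by exists 1 => // x /andP[/le_trans h /h]; rewrite leNgt ba.
have [c _ hc] := EVT_max ab (continuous_subspaceT cf).
exists (cabs (f c) + 1); first by rewrite ltr_wpDl ?cabs_ge0.
by move=> x xab; rewrite (le_trans (hc x _)) ?in_itv ?lerDl.
Qed.

Lemma ccont_bounded_below f (a b : R) : ccont f ->
  (forall x, a <= x <= b -> f x != 0) ->
  exists2 m, 0 < m & forall x, a <= x <= b -> m <= cabs (f x).
Proof.
move=> /ccont_cabs cf f0; have [ab|ba] := leP a b; last first.
  by exists 1 => // x /andP[/le_trans h /h]; rewrite leNgt ba.
have [c cab hc] := EVT_min ab (continuous_subspaceT cf).
exists (cabs (f c)); first by rewrite cabs_gt0 f0//; move: cab; rewrite in_itv.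
by move=> x xab; rewrite hc ?in_itv.
Qed.

End complex_valued_functions.

Section real_analysis.
Context {R : realType}.

Lemma ccont_eps (f : R -> R[i]) x e : ccont f -> 0 < e ->
  exists2 r, 0 < r & forall y, `|y - x| < r -> cabs (f y - f x) < e.
Proof.
move=> cf e0.
have /ccont_cabs/(_ x) : ccont (fun y => f y + (- f x)).
  by apply: ccontD => //; exact: ccont_cst.
move=> /cvgrPdist_lt/(_ e e0); rewrite subrr cabs0 => /nbhs_ballP[r /= r0 hr].
exists r => // y yr; have := hr y; rewrite /ball/= distrC => /(_ yr).
by rewrite sub0r normrN ger0_norm ?cabs_ge0.
Qed.

Lemma neg_interval (f : R -> R) (a b : R) : continuous f ->
  (forall x, a <= x <= b -> f x != 0) -> f a < 0 ->
  forall x, a <= x <= b -> f x < 0.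
Proof.
move=> cf f0 fa x /andP[ax xb]; rewrite ltNge; apply/negP => fx.
have /(IVT ax (continuous_subspaceT cf))[c] :
    Num.min (f a) (f x) <= 0 <= Num.max (f a) (f x).
  by rewrite ge_min le_max (ltW fa) fx orbT.
rewrite in_itv/= => /andP[ac cx] fc.
by move: (f0 c); rewrite fc eqxx ac (le_trans cx xb) => /(_ isT).
Qed.

Lemma pos_interval (f : R -> R) (a b : R) : continuous f ->
  (forall x, a <= x <= b -> f x != 0) -> 0 < f b ->
  forall x, a <= x <= b -> 0 < f x.
Proof.
move=> cf f0 fb x /andP[ax xb]; rewrite ltNge; apply/negP => fx.
have /(IVT xb (continuous_subspaceT cf))[c] :
    Num.min (f x) (f b) <= 0 <= Num.max (f x) (f b).
  by rewrite ge_min le_max (ltW fb) fx orbT.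
rewrite in_itv/= => /andP[xc cb] fc.
by move: (f0 c); rewrite fc eqxx cb (le_trans ax xc) => /(_ isT).
Qed.

(** Connectedness of the open half-line, in the form in which it serves to
    carry a property from large parameters down to all positive ones. *)
Lemma locally_constant_pos (P : R -> Prop) (T : R) :
  (forall t, 0 < t -> exists2 r, 0 < r & forall t1 t2, 0 < t1 -> 0 < t2 ->
     `|t1 - t| < r -> `|t2 - t| < r -> P t1 -> P t2) ->
  (forall t, T <= t -> P t) -> forall t, 0 < t -> P t.
Proof.
move=> loc PT t0 t00; pose T0 := Num.max T t0.
pose S := [set t | t0 <= t /\ P t].
have ST : S T0 by split; [rewrite le_max lexx orbT|apply: PT; rewrite le_max lexx].
have lbS : lbound S t0 by move=> t [].
have hS : has_inf S by split; [exists T0|exists t0].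
have it0 : t0 <= inf S by apply: lb_le_inf => //; exists T0.
have i0 : 0 < inf S by exact: lt_le_trans it0.
have [r r0 hr] := loc _ i0.
have [t [tt0 Pt] tr] := inf_adherent r0 hS.
have ti : inf S <= t by apply: ge_inf => //; exists t0.
have near t2 : 0 < t2 -> `|t2 - inf S| < r -> P t2.
  move=> t20 h; apply: (hr t) => //; first exact: lt_le_trans tt0.
  by rewrite ger0_norm ?subr_ge0// ltrBlDl.
have [e|lt] := eqVneq (inf S) t0; first by apply: near => //; rewrite e subrr normr0.
have {it0}lt : t0 < inf S by rewrite lt_neqAle eq_sym lt.
pose t2 := Num.max t0 (inf S - r / 2).
have t2i : t2 < inf S by rewrite gt_max lt; lra.
suff : inf S <= t2 by rewrite leNgt t2i.
have t02 : t0 <= t2 by rewrite le_max lexx.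
apply: ge_inf; first by exists t0.
split=> //; apply: near; first exact: lt_le_trans t02.
have : inf S - r / 2 <= t2 by rewrite le_max lexx orbT.
by move=> h; rewrite ler0_norm; lra.
Qed.

End real_analysis.

(** * Laurent polynomials in the exponential *)

Section laurent_polynomials.
Context {R : realType}.
Implicit Types (l : seq (int * R[i])) (s z c : R[i]).

(** A pair [(n, c)] stands for the monomial [c * expC (n s)]; repeated
    exponents are allowed, so that sums are concatenations. *)
Definition laurent l s : R[i] := \sum_(p <- l) p.2 * expC (p.1%:~R * s).

Definition is_laurent (q : R[i] -> R[i]) := exists l, forall s, q s = laurent l s.

Lemma is_laurent_monomial n c : is_laurent (fun s => c * expC (n%:~R * s)).
Proof. by exists [:: (n, c)] => s; rewrite /laurent big_seq1. Qed.

Lemma is_laurent_cst c : is_laurent (fun=> c).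
Proof.
have [l hl] := is_laurent_monomial 0 c.
by exists l => s; rewrite -hl mul0r expC0 mulr1.
Qed.

Lemma is_laurentD q1 q2 : is_laurent q1 -> is_laurent q2 ->
  is_laurent (fun s => q1 s + q2 s).
Proof.
move=> [l1 h1] [l2 h2]; exists (l1 ++ l2) => s.
by rewrite h1 h2 /laurent big_cat.
Qed.

Lemma is_laurentM q1 q2 : is_laurent q1 -> is_laurent q2 ->
  is_laurent (fun s => q1 s * q2 s).
Proof.
move=> [l1 h1] [l2 h2].
exists [seq (p1.1 + p2.1, p1.2 * p2.2) | p1 <- l1, p2 <- l2] => s.
rewrite h1 h2 /laurent big_allpairs_dep/= big_distrl/=; apply: eq_bigr => p1 _.
rewrite big_distrr/=; apply: eq_bigr => p2 _.
by rewrite intrD mulrDl expCD; ring.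
Qed.

Lemma is_laurentB q1 q2 : is_laurent q1 -> is_laurent q2 ->
  is_laurent (fun s => q1 s - q2 s).
Proof.
move=> h1 h2; have := is_laurentD h1 (is_laurentM (is_laurent_cst (-1)) h2).
by under eq_fun do rewrite mulN1r.
Qed.

Lemma laurent_eq l z s : expC z = expC s -> laurent l z = laurent l s.
Proof.
by move=> zs; apply: eq_bigr => p _; congr (_ * _); exact: expC_intM.
Qed.

Lemma ccont_laurent l z : ccont (fun x => laurent l (z * x%:C)).
Proof.
elim: l => [|p l ih].
  by under eq_fun do rewrite /laurent big_nil; exact: ccont_cst.
under eq_fun do rewrite /laurent big_cons.
apply: ccontD => //; apply: ccontM; first exact: ccont_cst.
by under eq_fun do rewrite mulrA; exact: ccont_expC.
Qed.

(** Newton's iteration [r <- r (3 - r^2 h) / 2] for an inverse square root of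
    [h] squares the error [r^2 h - 1] up to a constant, and its iterates stay
    polynomial in [r] and [h]. *)
Lemma newton_inverse_sqrt (G : set R[i]) (h r : R[i] -> R[i]) :
  is_laurent h -> is_laurent r ->
  (forall s, G s -> cabs (r s ^+ 2 * h s - 1) <= 2^-1) ->
  forall e, 0 < e -> exists2 r', is_laurent r' &
    forall s, G s -> cabs (r' s ^+ 2 * h s - 1) <= e.
Proof.
move=> Lh Lr hr e e0.
have H n : exists2 r', is_laurent r' &
    forall s, G s -> cabs (r' s ^+ 2 * h s - 1) <= n.+2%:R^-1.
  elim: n => [|n [r' Lr' hr']]; first by exists r.
  exists (fun s => r' s * ((3 - (r' s * r' s) * h s) / 2)).
    apply: is_laurentM => //; apply: is_laurentM; last exact: is_laurent_cst.
    apply: is_laurentB; first exact: is_laurent_cst.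
    by apply: is_laurentM => //; exact: is_laurentM.
  move=> s Gs; have := hr' s Gs; set d := cabs _ => hd.
  have d0 : 0 <= d by exact: cabs_ge0.
  have -> : (r' s * ((3 - r' s * r' s * h s) / 2)) ^+ 2 * h s - 1 =
      - ((r' s ^+ 2 * h s - 1) ^+ 2 * (3 + (1 - r' s ^+ 2 * h s)) / 4).
    by field.
  rewrite cabsN cabsM cabsV cabsM cabsX -/d.
  have -> : cabs (4 : R[i]) = 4 by exact: cabs_nat.
  have d2 : d <= 2^-1.
    by rewrite (le_trans hd)// lef_pV2 ?posrE ?ltr0n// ler_nat.
  have h3 : cabs (3 + (1 - r' s ^+ 2 * h s)) <= 3 + d.
    rewrite (le_trans (cabsD _ _))// (_ : cabs (3 : R[i]) = 3) ?cabs_nat//.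
    by rewrite lerD2l cabs_distC.
  have : d ^+ 2 * cabs (3 + (1 - r' s ^+ 2 * h s)) / 4 <= d / 2.
    have : d ^+ 2 * cabs (3 + (1 - r' s ^+ 2 * h s)) <= d * 2.
      by rewrite expr2 -mulrA ler_wpM2l//; nra.
    by lra.
  move=> /le_trans; apply; rewrite (@le_trans _ _ (n.+2%:R^-1 / 2))//.
    by rewrite ler_wpM2r.
  rewrite -invfM lef_pV2 ?posrE ?mulr_gt0 ?ltr0n// -natrM ler_nat; lia.
have [r' Lr' hr'] := H (Num.bound e^-1).
exists r' => // s Gs; rewrite (le_trans (hr' s Gs))//.
rewrite -[leRHS]invrK lef_pV2 ?posrE ?invr_gt0 ?ltr0n//.
have : e^-1 < (Num.bound e^-1)%:R by apply: archi_boundP; rewrite invr_ge0 ltW.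
by move=> /ltW/le_trans; apply; rewrite ler_nat; lia.
Qed.

End laurent_polynomials.

(** * The closed curve *)

Section closed_curve.
Context {R : realType}.
Variables (a : R[i]) (y : R).
Hypothesis ay : `|Cim a - y * Cre a| < 1.

(** [branch true * x] and [branch false * x], for [0 <= x <= pi], are two segments that
    issue from [0] and whose other ends differ by [2 i pi]; their images by
    [expC] together form a Jordan curve around [0]. *)
Definition branch (b : bool) : R[i] := a + (if b then 'i%C else - 'i%C).

Definition curve : set R[i] :=
  [set s | exists b x, 0 <= x <= pi /\ s = branch b * x%:C].

Lemma curve_branch b x : 0 <= x <= pi -> curve (branch b * x%:C).
Proof. by move=> hx; exists b, x. Qed.

(* The direction in which the curve is translated off itself. *)
Let d : R[i] := 1 +i* y.

(** In the real coordinates [Re z] and [Im z - y * Re z], the direction [d] is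
    the first axis, and the curve is the graph of a function of the second
    coordinate, which ranges over an interval of length [2 pi].  So the translate
    of the curve by a multiple [t d] does not meet the curve modulo [2 i pi]
    unless [t = 0], and the curve itself is simple modulo [2 i pi]. *)
Lemma curve_separation b1 b2 (x1 x2 t : R) :
  0 <= x1 <= pi -> 0 <= x2 <= pi ->
  expC (branch b1 * x1%:C - branch b2 * x2%:C + d * t%:C) = 1 ->
  [/\ x1 = x2, t = 0 & [\/ b1 = b2, x1 = 0 | x1 = pi]].
Proof.
move=> /andP[x10 x1p] /andP[x20 x2p].
pose q := Cim a - y * Cre a.
have q1 : -1 < q < 1 by move: ay; rewrite ltr_norml.
have pi0 := pi_gt0 R.
pose e b : R := if b then 1 else -1.
set z := _ + _ * _ => ez.
have Rez : Cre z = Cre a * (x1 - x2) + t.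
  rewrite /z /branch /d; clear z ez; case: a => p p'; rewrite !(ReD, ReN, ReM)/=.
  by case: b1; case: b2 => /=; ring.
have Imz : Cim z = (q + e b1) * x1 - (q + e b2) * x2 + y * Cre z.
  rewrite Rez /z /branch /d /q; clear z ez Rez; case: a => p p'; rewrite !(ImD, ImN, ImM)/=.
  by case: b1; case: b2 => /=; ring.
have re0 : Cre z = 0.
  apply: (@expR_inj R); rewrite expR0 -cabs_expC ez; exact: cabs1.
rewrite re0 mulr0 addr0 in Imz.
move/andP: q1 => [q1 q2].
have bound : `|Cim z| <= pi *+ 2.
  rewrite Imz ler_norml mulr2n; clear -x10 x1p x20 x2p q1 q2 pi0.
  by rewrite /e; case: b1; case: b2; apply/andP; split; nra.
have [_ im] := expC_eq1 ez bound.
have x12 : x1 = x2 /\ [\/ b1 = b2, x1 = 0 | x1 = pi].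
  move: im; rewrite Imz mulr2n; clear -x10 x1p x20 x2p q1 q2 pi0; rewrite /e.
  have [p1 p2] : 0 < (1 - q) * pi /\ 0 < (1 + q) * pi.
    by split; apply: mulr_gt0 => //; lra.
  have [[r1 r2] [r3 r4]] : (0 <= (1 + q) * (pi - x1) /\ 0 <= (1 + q) * (pi - x2)) /\
      (0 <= (1 - q) * (pi - x1) /\ 0 <= (1 - q) * (pi - x2)).
    by split; split; apply: mulr_ge0; lra.
  have [[s1 s2] [s3 s4]] : (0 <= (1 + q) * x1 /\ 0 <= (1 + q) * x2) /\
      (0 <= (1 - q) * x1 /\ 0 <= (1 - q) * x2).
    by split; split; apply: mulr_ge0; lra.
  case: b1; case: b2 => -[im|im].
  - by split; [nra|constructor].
  - by exfalso; move: im; case: ger0P => _ im; lra.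
  - have [-> ->] : x1 = 0 /\ x2 = 0 by split; nra.
    by split=> //; constructor 2.
  - have [-> ->] : x1 = pi /\ x2 = pi by move: im; case: ger0P => im0 im; split; nra.
    by split=> //; constructor 3.
  - have [-> ->] : x1 = 0 /\ x2 = 0 by split; nra.
    by split=> //; constructor 2.
  - have [-> ->] : x1 = pi /\ x2 = pi by move: im; case: ger0P => im0 im; split; nra.
    by split=> //; constructor 3.
  - by split; [nra|constructor].
  - by exfalso; move: im; case: ger0P => _ im; lra.
case: x12 => x12 bb; split=> //; move: re0; rewrite Rez x12; lra.
Qed.

End closed_curve.

(** * Approximate square roots on the curve *)

Section square_roots.
Context {R : realType}.
Variables (a : R[i]) (y : R).
Hypothesis ay : `|Cim a - y * Cre a| < 1.

Let d : R[i] := 1 +i* y.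
Let G : set R[i] := curve a.

Section perturbed_square.
Variable sg : R[i].
Hypothesis Gsg : G sg.

Let om (t : R) : R[i] := expC (- d * t%:C).

(** This is [(1 - expC (sg - s - d t)) * (1 - expC (s - sg - d t))], whose
    zeros are on both sides of the curve for [0 < t]; the expanded form shows
    that it is a Laurent polynomial in [expC s]. *)
Let h (t : R) (s : R[i]) : R[i] :=
  1 + om t ^+ 2 - om t * (expC (sg - s) + expC (s - sg)).

Let is_laurent_h t : is_laurent (h t).
Proof.
have -> : h t = (fun s => (1 + om t ^+ 2) - om t * (expC sg * expC ((-1)%:~R * s) +
    expC (- sg) * expC (1%:~R * s))).
  by apply/funext => s; rewrite -!expCD mulrN1z mulN1r mul1r [- sg + s]addrC.
apply: is_laurentB; first exact: is_laurent_cst.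
apply: is_laurentM; first exact: is_laurent_cst.
by apply: is_laurentD; exact: is_laurent_monomial.
Qed.

Let h_neq0 t s : 0 < t -> G s -> h t s != 0.
Proof.
move=> t0 Gs.
have -> : h t s = (1 - expC (sg - s + d * (- t)%:C)) * (1 - expC (s - sg + d * (- t)%:C)).
  rewrite /h /om !expCD rmorphN mulrN mulNr !expCN.
  by field; rewrite !expC_neq0.
have sep s1 s2 : G s1 -> G s2 -> 1 - expC (s1 - s2 + d * (- t)%:C) != 0.
  move=> [b1 [x1 [x1p ->]]] [b2 [x2 [x2p ->]]].
  rewrite subr_eq0 eq_sym; apply/negP => /eqP /(curve_separation ay x1p x2p)[_ /eqP].
  by rewrite oppr_eq0 gt_eqF.
by rewrite mulf_neq0// sep.
Qed.

Let cabs_om t : cabs (om t) = expR (- t).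
Proof.
rewrite cabs_expC ReM ReN ImN /=; congr expR; ring.
Qed.

Let h_bound : exists2 M, 0 < M &
  forall s, G s -> cabs (expC (sg - s) + expC (s - sg)) <= M.
Proof.
have B b : exists2 M, 0 < M & forall x, 0 <= x <= pi ->
    cabs (expC (sg - branch a b * x%:C) + expC (branch a b * x%:C - sg)) <= M.
  apply: ccont_bounded.
  under eq_fun do rewrite !expCD -mulNr.
  apply: ccontD; apply: ccontM; try exact: ccont_cst; exact: ccont_expC.
have [M1 M10 h1] := B true; have [M2 M20 h2] := B false.
exists (M1 + M2); first by rewrite addr_gt0.
move=> _ [[] [x [xp ->]]].
  by rewrite (le_trans (h1 x xp))// lerDl ltW.
by rewrite (le_trans (h2 x xp))// lerDr ltW.
Qed.

Let h_bounded_below t : 0 < t -> exists2 m, 0 < m & forall s, G s -> m <= cabs (h t s).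
Proof.
move=> t0.
have B b : exists2 m, 0 < m & forall x, 0 <= x <= pi -> m <= cabs (h t (branch a b * x%:C)).
  apply: ccont_bounded_below; last by move=> x xp; apply: h_neq0 => //; exact: curve_branch.
  have [l hl] := is_laurent_h t.
  by under eq_fun do rewrite hl; exact: ccont_laurent.
have [m1 m10 h1] := B true; have [m2 m20 h2] := B false.
exists (Num.min m1 m2); first by rewrite lt_min m10.
move=> _ [[] [x [xp ->]]].
  by rewrite (le_trans _ (h1 x xp))// ge_min lexx.
by rewrite (le_trans _ (h2 x xp))// ge_min lexx orbT.
Qed.

Let dist_h t1 t2 s M : 0 <= t1 -> 0 <= t2 ->
  cabs (expC (sg - s) + expC (s - sg)) <= M ->
  cabs (h t1 s - h t2 s) <= cabs (om t1 - om t2) * (2 + M).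
Proof.
move=> t10 t20 hM.
have -> : h t1 s - h t2 s =
    (om t1 - om t2) * ((om t1 + om t2) - (expC (sg - s) + expC (s - sg))).
  by rewrite /h; ring.
rewrite cabsM ler_wpM2l ?cabs_ge0// (le_trans (cabsB _ _))// lerD//.
rewrite (le_trans (cabsD _ _))// !cabs_om.
have e1 : expR (- t1) <= 1 by rewrite -expR0 ler_expR oppr_le0.
have e2 : expR (- t2) <= 1 by rewrite -expR0 ler_expR oppr_le0.
by lra.
Qed.

(** An approximate inverse square root of [h t1], inserted in [h t2], is a
    starting point for Newton's iteration as soon as [t1] and [t2] are close,
    so the property propagates from large [t], where [1] is such a starting
    point, to all positive [t]. *)
Let inverse_sqrt_h t : 0 < t -> forall e, 0 < e -> exists2 r, is_laurent r &
  forall s, G s -> cabs (r s ^+ 2 * h t s - 1) <= e.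
Proof.
have [M M0 hM] := h_bound.
pose T := 4 * (1 + M).
move: t; apply: (@locally_constant_pos _ (fun t => forall e, 0 < e ->
    exists2 r, is_laurent r & forall s, G s -> cabs (r s ^+ 2 * h t s - 1) <= e) T)
  => t; [move=> t0|move=> tT].
  have [m m0 hm] := h_bounded_below t0.
  have e0 : 0 < m / (20 * (2 + M)) by rewrite divr_gt0 ?mulr_gt0 ?addr_gt0.
  have com : ccont om by exact: ccont_expC.
  have [r r0 hr] := ccont_eps t com e0.
  exists r => // t1 t2 t10 t20 t1r t2r.
  have near t' : 0 < t' -> `|t' - t| < r -> forall s, G s ->
      cabs (h t' s - h t s) <= m / 20.
    move=> t'0 t'r s Gs; rewrite (le_trans (dist_h (ltW t'0) (ltW t0) (hM s Gs)))//.
    rewrite (_ : m / 20 = m / (20 * (2 + M)) * (2 + M)); last first.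
      by field; lra.
    by apply: ler_wpM2r; [lra|exact/ltW/hr].
  have q0 : 0 < 4%:R^-1 :> R by rewrite invr_gt0.
  move=> /(_ _ q0)[r1 Lr1 hr1]; apply: (newton_inverse_sqrt (is_laurent_h t2) Lr1).
  move=> s Gs; have := hr1 s Gs.
  have := near _ t10 t1r s Gs; have := near _ t20 t2r s Gs; have := hm s Gs.
  set k1 := h t1 s; set k2 := h t2 s; set k := h t s; set p := r1 s.
  move=> mk d2 d1 e1.
  have k1m : cabs k <= cabs k1 + m / 20.
    rewrite -[k](subrK k1) addrC (le_trans (cabsD _ _))// lerD2l.
    by rewrite cabs_distC.
  have k12 : cabs (k2 - k1) <= m / 10.
    have -> : k2 - k1 = (k2 - k) + (k - k1) by ring.
    rewrite (le_trans (cabsD _ _))// [cabs (k - k1)]cabs_distC; lra.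
  have pk : cabs p ^+ 2 * cabs k1 <= 5 / 4.
    rewrite -cabsX -cabsM -[_ * _](subrK 1) (le_trans (cabsD _ _))// cabs1; lra.
  have -> : p ^+ 2 * k2 - 1 = (p ^+ 2 * k1 - 1) + p ^+ 2 * (k2 - k1) by ring.
  rewrite (le_trans (cabsD _ _))// [cabs (_ * (k2 - k1))]cabsM cabsX.
  have p0 : 0 <= cabs p ^+ 2 by rewrite exprn_ge0 ?cabs_ge0.
  have : cabs p ^+ 2 * cabs (k2 - k1) <= cabs p ^+ 2 * (cabs k1 / 5).
    by rewrite ler_wpM2l//; lra.
  lra.
apply: (newton_inverse_sqrt (is_laurent_h t) (is_laurent_cst 1)) => s Gs.
rewrite expr1n mul1r.
have -> : h t s - 1 = om t * (om t - (expC (sg - s) + expC (s - sg))).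
  by rewrite /h; ring.
rewrite cabsM cabs_om.
have t0 : 0 < 1 + t by move: tT; rewrite /T; lra.
have et : expR (- t) <= (1 + t)^-1.
  rewrite expRN lef_pV2 ?posrE ?expR_gt0//; exact: expR_ge1Dx.
have et1 : expR (- t) <= 1 by rewrite -expR0 ler_expR; move: tT; rewrite /T; lra.
have b1 : cabs (om t - (expC (sg - s) + expC (s - sg))) <= 1 + M.
  by rewrite (le_trans (cabsB _ _))// lerD// ?hM// cabs_om.
apply: (@le_trans _ _ ((1 + t)^-1 * (1 + M))).
  by apply: ler_pM; rewrite ?expR_ge0 ?cabs_ge0.
by rewrite ler_pdivrMl//; move: tT; rewrite /T; lra.
Qed.

(** If [r ^+ 2 * h t] is close to [1], then ['i * r * h t] squares to nearly
    [- h t], and [h t] tends to [h 0] uniformly on the curve as [t] tends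
    to [0]. *)
Lemma laurent_sqrt e : 0 < e -> exists l, forall s, G s ->
  cabs (laurent l s ^+ 2 + (2 - (expC (sg - s) + expC (s - sg)))) <= e.
Proof.
move=> e0; have [M M0 hM] := h_bound.
have M20 : 0 < 2 + M by rewrite addr_gt0.
have om0 : om 0 = 1 by rewrite /om mulr0 expC0.
have com : ccont om by exact: ccont_expC.
have e1 : 0 < e / (2 * (2 + M)) by rewrite divr_gt0 ?mulr_gt0.
have [r r0 hr] := ccont_eps 0 com e1.
have r20 : 0 < r / 2 by rewrite divr_gt0.
have e2 : 0 < e / (2 * (4 + (2 + M))) by rewrite divr_gt0 ?mulr_gt0 ?addr_gt0.
have [q Lq hq] := inverse_sqrt_h r20 e2.
have [l hl] := is_laurentM (is_laurent_cst 'i%C) (is_laurentM Lq (is_laurent_h (r / 2))).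
exists l => s Gs; rewrite -hl; have := hq s Gs; set k := h (r / 2) s; set p := q s => hp.
have h0s : 2 - (expC (sg - s) + expC (s - sg)) = h 0 s.
  by rewrite /h om0 expr1n mul1r.
rewrite h0s.
have hk : cabs (k - h 0 s) <= e / 2.
  rewrite (le_trans (dist_h (ltW r20) (lexx 0) (hM s Gs)))//.
  rewrite (_ : e / 2 = e / (2 * (2 + M)) * (2 + M)); last by field; lra.
  apply: ler_wpM2r; [exact: ltW|apply/ltW/hr].
  by rewrite subr0 ger0_norm; lra.
have kM : cabs k <= 4 + (2 + M).
  rewrite /k /h (le_trans (cabsB _ _))//.
  have c1 : cabs (om (r / 2)) <= 1 by rewrite cabs_om -[leRHS]expR0 ler_expR; lra.
  have c2 : cabs (1 + om (r / 2) ^+ 2) <= 2.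
    rewrite (le_trans (cabsD _ _))// cabs1 cabsX (_ : 2 = 1 + 1)// lerD2l.
    by rewrite expr_le1 ?cabs_ge0.
  have : cabs (om (r / 2) * (expC (sg - s) + expC (s - sg))) <= 1 * M.
    by rewrite cabsM ler_pM ?cabs_ge0// hM.
  lra.
have -> : ('i%C * (p * k)) ^+ 2 + h 0 s = - ((p ^+ 2 * k - 1) * k + (k - h 0 s)).
  rewrite exprMn sqr_i; ring.
rewrite cabsN (le_trans (cabsD _ _))// (_ : e = e / 2 + e / 2); last by lra.
rewrite lerD// cabsM (_ : e / 2 = e / (2 * (4 + (2 + M))) * (4 + (2 + M))).
  by apply: ler_pM => //; exact: cabs_ge0.
by field; lra.
Qed.

End perturbed_square.

Definition half_exp (z : R[i]) (x : R) : R[i] := expC (z / 2 * x%:C).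

(** This is [2 expC (sg / 2) sinh ((s - sg) / 2)] at [s = v x] and
    [sg = z x0]. *)
Definition half_sinh (z : R[i]) (x0 : R) (v : R[i]) (x : R) : R[i] :=
  half_exp v x - half_exp z x0 ^+ 2 / half_exp v x.

Definition sgn_at (x0 x : R) : R[i] := if x0 <= x then 1 else -1.

Lemma half_exp_neq0 z x : half_exp z x != 0. Proof. exact: expC_neq0. Qed.

Lemma half_exp_sqr z x : half_exp z x ^+ 2 = expC (z * x%:C).
Proof.
by rewrite expr2 -expCD; congr expC; field.
Qed.

Lemma half_exp0 z : half_exp z 0 = 1. Proof. by rewrite /half_exp mulr0 expC0. Qed.

Lemma ccont_half_sinh z x0 v : ccont (half_sinh z x0 v).
Proof.
have -> : half_sinh z x0 v = (fun x => expC (v / 2 * x%:C) +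
    (- half_exp z x0 ^+ 2) * expC (- (v / 2) * x%:C)).
  by apply/funext => x; rewrite /half_sinh /half_exp mulNr -expCN mulNr.
exact: (ccontD (ccont_expC _) (ccontM (ccont_cst _) (ccont_expC _))).
Qed.

Lemma half_sinh_eq0 b x0 b' x : 0 < x0 < pi -> 0 <= x <= pi ->
  half_sinh (branch a b) x0 (branch a b') x = 0 -> b' = b /\ x = x0.
Proof.
move=> /andP[x00 x0p] xp /eqP; rewrite subr_eq0 => /eqP e.
have x0p' : 0 <= x0 <= pi by rewrite !ltW.
have : expC (branch a b' * x%:C - branch a b * x0%:C + d * 0%:C) = 1.
  rewrite mulr0 addr0 expCD expCN -!half_exp_sqr expr2 {1}e.
  by field; rewrite !half_exp_neq0.
move/(curve_separation ay xp x0p')=> [xx0 _] [->//|h|h]; rewrite xx0 in h.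
  by rewrite h ltxx in x00.
by rewrite h ltxx in x0p.
Qed.

Lemma half_exp_pi : half_exp (branch a true) pi = - half_exp (branch a false) pi.
Proof.
rewrite /half_exp -mulN1r -expC_ipi -expCD; congr expC.
by rewrite /branch; move: ('i%C : R[i]) => i /=; field.
Qed.

Lemma expC_branch_pi : expC (branch a true * pi%:C) = expC (branch a false * pi%:C).
Proof. by rewrite -!half_exp_sqr half_exp_pi sqrrN. Qed.

End square_roots.

(** * The sign of an approximate square root *)

Section sign_coherence.
Context {R : realType}.
Implicit Types z w q k : R[i].

(** The real inner product of the plane. *)
Definition dotC z w : R := Cre z * Cre w + Cim z * Cim w.

Lemma dotCNl z w : dotC (- z) w = - dotC z w.
Proof. by rewrite /dotC ReN ImN; ring. Qed.

Lemma dotCNr z w : dotC z (- w) = - dotC z w.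
Proof. by rewrite /dotC ReN ImN; ring. Qed.

Lemma continuous_dotC (f g : R -> R[i]) : ccont f -> ccont g ->
  continuous (fun x => dotC (f x) (g x)).
Proof.
move=> [f1 f2] [g1 g2] x; rewrite /dotC.
apply: (@cvgD _ _ _ _ _ (fun x => Cre (f x) * Cre (g x))
  (fun x => Cim (f x) * Cim (g x))).
  by apply: (@cvgM _ _ _ _ (Cre \o f) (Cre \o g)); [exact: f1|exact: g1].
by apply: (@cvgM _ _ _ _ (Cim \o f) (Cim \o g)); [exact: f2|exact: g2].
Qed.

Lemma sqr_cabsB z w : cabs (z - w) ^+ 2 = cabs z ^+ 2 - 2 * dotC z w + cabs w ^+ 2.
Proof. by rewrite !sqr_cabs /dotC ReD ImD ReN ImN; ring. Qed.

Lemma dotC_gt0 q k : cabs (q - k) < cabs k -> 0 < dotC q k.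
Proof.
move=> h; have : cabs (q - k) ^+ 2 < cabs k ^+ 2.
  by rewrite ltr_pXn2r ?nnegrE ?cabs_ge0.
rewrite sqr_cabsB; have := sqr_ge0 (cabs q); lra.
Qed.

Lemma sqrt_dichotomy q k e : 0 <= e -> cabs (q ^+ 2 - k ^+ 2) <= e ^+ 2 ->
  cabs (q - k) <= e \/ cabs (q + k) <= e.
Proof.
move=> e0; rewrite subr_sqr cabsM => h.
have [|h1] := leP (cabs (q - k)) e; first by left.
right; rewrite leNgt; apply/negP => h2.
have := cabs_ge0 (q - k); have := cabs_ge0 (q + k); nra.
Qed.

Lemma sqrt_sign q k e : 0 <= e -> e < cabs k -> cabs (q ^+ 2 - k ^+ 2) <= e ^+ 2 ->
  (0 < dotC q k /\ cabs (q - k) <= e) \/ (dotC q k < 0 /\ cabs (q + k) <= e).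
Proof.
move=> e0 ek /(sqrt_dichotomy e0)[h|h]; [left|right]; split=> //.
  by apply: dotC_gt0; exact: le_lt_trans ek.
rewrite -oppr_gt0 -dotCNr; apply: dotC_gt0; rewrite cabsN opprK.
exact: le_lt_trans ek.
Qed.

Variables (a : R[i]) (y : R).
Hypothesis ay : `|Cim a - y * Cre a| < 1.

Lemma half_sinh_sqr z x0 v (x : R) : half_sinh z x0 v x ^+ 2 =
  - half_exp z x0 ^+ 2 * (2 - (expC (z * x0%:C - v * x%:C) + expC (v * x%:C - z * x0%:C))).
Proof.
rewrite !expCD !expCN -!half_exp_sqr /half_sinh.
by field; rewrite !half_exp_neq0.
Qed.

(** An approximate square root of [half_sinh ^+ 2] is close to [half_sinh] or to
    its opposite, and by the intermediate value theorem the choice is constant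
    on each arc where [half_sinh] does not vanish.  At the two ends of the
    branches [half_sinh] has opposite values whereas a Laurent polynomial has
    equal ones, so the choice changes at the vanishing point [x0]. *)
Lemma laurent_sign b x0 e : 0 < x0 < pi -> 0 < e -> exists l,
  forall x, 0 <= x <= pi ->
  cabs (laurent l (branch a b * x%:C) -
        sgn_at x0 x * half_sinh (branch a b) x0 (branch a b) x) <= e /\
  cabs (laurent l (branch a (~~ b) * x%:C) +
        half_sinh (branch a b) x0 (branch a (~~ b)) x) <= e.
Proof.
move=> x0p e0; have [x00 x0pi] := andP x0p.
pose k b' x := half_sinh (branch a b) x0 (branch a b') x.
have ck b' : ccont (k b') by exact: ccont_half_sinh.
have kx0 : k b x0 = 0.
  by rewrite /k /half_sinh expr2 -mulrA mulfV ?half_exp_neq0// mulr1 subrr.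
have pi0 := pi_gt0 R.
have k00 : k b 0 = k (~~ b) 0 by rewrite /k /half_sinh !half_exp0.
have kpi : k b pi = - k (~~ b) pi.
  rewrite /k /half_sinh; case: (b) => /=; rewrite half_exp_pi ?invrN; ring.
have e4 : 0 < e / 4 by rewrite divr_gt0.
have [r r0 hr] := ccont_eps x0 (ck b) e4.
pose dl := Num.min (r / 2) (Num.min (x0 / 2) ((pi - x0) / 2)).
have dl0 : 0 < dl by rewrite !lt_min !divr_gt0 ?subr_gt0.
have dlr : dl <= r / 2 by rewrite ge_min lexx.
have dlx : dl <= x0 / 2 by rewrite !ge_min lexx orbT.
have dlp : dl <= (pi - x0) / 2 by rewrite !ge_min lexx !orbT.
have [m1 m10 hm1] : exists2 m, 0 < m & forall x, 0 <= x <= x0 - dl -> m <= cabs (k b x).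
  apply: ccont_bounded_below => // x /andP[h1 h2]; apply/negP => /eqP.
  move=> /(half_sinh_eq0 ay x0p)[]; [by apply/andP; split; lra|].
  by move=> _ h; move: h2; rewrite h; lra.
have [m2 m20 hm2] : exists2 m, 0 < m & forall x, x0 + dl <= x <= pi -> m <= cabs (k b x).
  apply: ccont_bounded_below => // x /andP[h1 h2]; apply/negP => /eqP.
  move=> /(half_sinh_eq0 ay x0p)[]; [by apply/andP; split; lra|].
  by move=> _ h; move: h1; rewrite h; lra.
have [m3 m30 hm3] : exists2 m, 0 < m & forall x, 0 <= x <= pi -> m <= cabs (k (~~ b) x).
  apply: ccont_bounded_below => // x xp; apply/negP => /eqP.
  by move=> /(half_sinh_eq0 ay x0p xp)[]; case: (b).
pose m := Num.min (e / 2) (Num.min (m1 / 2) (Num.min (m2 / 2) (m3 / 2))).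
have m0 : 0 < m by rewrite !lt_min !divr_gt0.
have me : m <= e / 2 by rewrite ge_min lexx.
have mm1 : m <= m1 / 2 by rewrite !ge_min lexx !orbT.
have mm2 : m <= m2 / 2 by rewrite !ge_min lexx !orbT.
have mm3 : m <= m3 / 2 by rewrite !ge_min lexx !orbT.
have m_ge0 : 0 <= m by exact: ltW.
(* The sign at the common origin of the branches is normalised by replacing the
   square root by its opposite if necessary. *)
have [l [hl hl0]] : exists l, (forall b' x, 0 <= x <= pi ->
    cabs (laurent l (branch a b' * x%:C) ^+ 2 - k b' x ^+ 2) <= m ^+ 2) /\
    dotC (laurent l 0) (k b 0) < 0.
  have Gsg : curve a (branch a b * x0%:C) by apply: curve_branch; rewrite !ltW.
  set t := half_exp (branch a b) x0.
  have t0 : 0 < cabs t by rewrite cabs_gt0 half_exp_neq0.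
  have et : 0 < m ^+ 2 / cabs t ^+ 2 by rewrite divr_gt0// exprn_gt0.
  have [l hl] := laurent_sqrt ay Gsg et.
  have appr c : c ^+ 2 = t ^+ 2 -> exists2 l', forall s, laurent l' s = c * laurent l s &
      forall b' x, 0 <= x <= pi ->
      cabs (laurent l' (branch a b' * x%:C) ^+ 2 - k b' x ^+ 2) <= m ^+ 2.
    move=> ct; have [l' hl'] := is_laurentM (is_laurent_cst c)
      (ex_intro (fun l' => forall s, laurent l s = laurent l' s) l (fun=> erefl)).
    exists l' => [s//|b' x xp]; rewrite -hl' exprMn ct half_sinh_sqr -/t.
    rewrite mulNr opprK -mulrDr cabsM cabsX mulrC -ler_pdivlMr ?exprn_gt0//.
    by apply: hl; exact: curve_branch.
  have [l1 hl1 hk1] := appr t erefl.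
  have [l2 hl2 hk2] := appr (- t) (sqrrN _).
  have k0 : m < cabs (k b 0).
    have h00 : 0 <= (0 : R) <= x0 - dl by apply/andP; split; lra.
    by have := hm1 0 h00; lra.
  have h0 : 0 <= (0 : R) <= pi by rewrite lexx ltW.
  have := hk1 b 0 h0; rewrite mulr0.
  case/(sqrt_sign m_ge0 k0) => -[s0 _]; [exists l2|exists l1]; split=> //.
  by rewrite hl2 mulNr -hl1 dotCNl oppr_lt0.
exists l => x xp.
pose q b' x := laurent l (branch a b' * x%:C).
have cdot b' : continuous (fun x => dotC (q b' x) (k b' x)).
  by apply: continuous_dotC => //; exact: ccont_laurent.
have nz b' x' : 0 <= x' <= pi -> m < cabs (k b' x') -> dotC (q b' x') (k b' x') != 0.
  by move=> x'p mk; case: (sqrt_sign m_ge0 mk (hl b' x' x'p)) => -[h _];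
    [rewrite gt_eqF|rewrite lt_eqF].
have other x' : 0 <= x' <= pi -> dotC (q (~~ b) x') (k (~~ b) x') < 0.
  move: x'; apply: (@neg_interval _ (fun x => dotC (q (~~ b) x) (k (~~ b) x)) 0 pi)
    => // [x'' x''p|].
    by apply: nz => //; have := hm3 x'' x''p; lra.
  by rewrite /q mulr0 -k00.
split; last first.
  have mk : m < cabs (k (~~ b) x) by have := hm3 x xp; lra.
  case: (sqrt_sign m_ge0 mk (hl (~~ b) x xp)) => -[s h].
    by have := other x xp; rewrite ltNge ltW.
  by rewrite (le_trans h)//; lra.
have [x0x xpi] := andP xp.
(* Left part of the first branch: it is joined to the other branch at [0]. *)
have [xl|xl] := leP x (x0 - dl).
  have xin : 0 <= x <= x0 - dl by rewrite x0x xl.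
  have s0 : dotC (q b x) (k b x) < 0.
    apply: (@neg_interval _ (fun x => dotC (q b x) (k b x)) 0 (x0 - dl)) => //.
      move=> x' x'in; apply: nz; last by have := hm1 x' x'in; lra.
      by have [h1 h2] := andP x'in; apply/andP; split; lra.
    by rewrite /q mulr0.
  have mk : m < cabs (k b x) by have := hm1 x xin; lra.
  have -> : sgn_at x0 x = -1 by rewrite /sgn_at leNgt (_ : x < x0)//; lra.
  case: (sqrt_sign m_ge0 mk (hl b x xp)) => -[s h]; first by move: s; rewrite ltNge ltW.
  by rewrite mulN1r opprK (le_trans h)//; lra.
(* Right part of the first branch: it is joined to the other branch at [pi]. *)
have [xr|xr] := leP (x0 + dl) x.
  have xin : x0 + dl <= x <= pi by rewrite xr.
  have s0 : 0 < dotC (q b x) (k b x).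
    apply: (@pos_interval _ (fun x => dotC (q b x) (k b x)) (x0 + dl) pi) => //.
      move=> x' x'in; apply: nz; last by have := hm2 x' x'in; lra.
      by have [h1 h2] := andP x'in; apply/andP; split; lra.
    have -> : q b pi = q (~~ b) pi.
      by apply: laurent_eq; case: (b); rewrite /= expC_branch_pi.
    by rewrite kpi dotCNr oppr_gt0 other// lexx ltW.
  have mk : m < cabs (k b x) by have := hm2 x xin; lra.
  have -> : sgn_at x0 x = 1 by rewrite /sgn_at (_ : x0 <= x)//; lra.
  case: (sqrt_sign m_ge0 mk (hl b x xp)) => -[s h]; last by move: s; rewrite ltNge ltW.
  by rewrite mul1r (le_trans h)//; lra.
(* Near [x0] both signs will do, because [half_sinh] is small there. *)
have kx : cabs (k b x) <= e / 4.
  have := hr x; rewrite kx0 subr0 => h; apply/ltW/h.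
  by rewrite ltr_norml; apply/andP; split; lra.
have sk c : c = 1 \/ c = -1 -> cabs (q b x - c * k b x) <= e.
  move=> hc; have [h|h] := sqrt_dichotomy m_ge0 (hl b x xp);
      case: hc => ->; rewrite ?mul1r ?mulN1r ?opprK.
  - by rewrite (le_trans h)//; lra.
  - have -> : q b x + k b x = (q b x - k b x) + k b x * 2 by ring.
    rewrite (le_trans (cabsD _ _))// [cabs (_ * 2)]cabsM cabs_nat.
    by move: h; rewrite -/(q b x) => h; lra.
  - have -> : q b x - k b x = (q b x + k b x) - k b x * 2 by ring.
    rewrite (le_trans (cabsB _ _))// [cabs (_ * 2)]cabsM cabs_nat.
    by move: h; rewrite -/(q b x) => h; lra.
  - by rewrite (le_trans h)//; lra.
by apply: sk; rewrite /sgn_at; case: ifP; [left|right].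
Qed.

End sign_coherence.

(** * The square norm *)

Section square_norm.
Context {R : realType}.
Implicit Types (v w : 'cV[R[i]]_2) (f g : R -> 'cV[R[i]]_2).

Lemma sqnormC2E v : sqnormC2 v = cabs (v ord0 ord0) ^+ 2 + cabs (v (lift ord0 ord0) ord0) ^+ 2.
Proof. by rewrite /sqnormC2 big_ord_recl big_ord1 !sqr_cabs. Qed.

Lemma sqnormC2_ge0 v : 0 <= sqnormC2 v.
Proof. by rewrite sqnormC2E addr_ge0// sqr_ge0. Qed.

Lemma sqnormC2_0 : sqnormC2 (0 : 'cV[R[i]]_2) = 0.
Proof. by rewrite sqnormC2E !mxE cabs0 expr0n addr0. Qed.

Lemma sqnormC2Z c v : sqnormC2 (c *: v) = cabs c ^+ 2 * sqnormC2 v.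
Proof. by rewrite !sqnormC2E !mxE !cabsM !exprMn mulrDr. Qed.

Lemma sqnormC2D v w : sqnormC2 (v + w) <= 2 * sqnormC2 v + 2 * sqnormC2 w.
Proof.
have H (z t : R[i]) : cabs (z + t) ^+ 2 <= 2 * cabs z ^+ 2 + 2 * cabs t ^+ 2.
  have : cabs (z + t) ^+ 2 <= (cabs z + cabs t) ^+ 2.
    by rewrite ler_pXn2r ?nnegrE ?addr_ge0 ?cabs_ge0 ?cabsD.
  have := sqr_ge0 (cabs z - cabs t); nra.
rewrite !sqnormC2E !mxE.
have := H (v ord0 ord0) (w ord0 ord0).
by have := H (v (lift ord0 ord0) ord0) (w (lift ord0 ord0) ord0); lra.
Qed.

Definition vec2 (p q : R -> R[i]) (x : R) : 'cV[R[i]]_2 :=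
  \col_(j < 2) if j == ord0 then p x else q x.

Lemma sqnormC2_vec2 p q x : sqnormC2 (vec2 p q x) = cabs (p x) ^+ 2 + cabs (q x) ^+ 2.
Proof. by rewrite sqnormC2E !mxE. Qed.

Lemma vec2P v w : v ord0 ord0 = w ord0 ord0 ->
  v (lift ord0 ord0) ord0 = w (lift ord0 ord0) ord0 -> v = w.
Proof.
move=> h0 h1; apply/colP => j.
by have [k ->|->//] := unliftP ord0 j; rewrite (ord1 k).
Qed.

Notation I := (`[0, pi : R]%classic).
Notation mu := (@lebesgue_measure R).

Definition mvec f :=
  (forall j, measurable_fun I (fun x : R => Cre (f x j ord0))) /\
  (forall j, measurable_fun I (fun x : R => Cim (f x j ord0))).

Definition sqint f : \bar R := (\int[mu]_(x in I) (sqnormC2 (f x))%:E)%E.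

Lemma mvec_sqnorm f : mvec f -> measurable_fun I (fun x => sqnormC2 (f x)).
Proof.
move=> [f1 f2]; rewrite (_ : (fun x => _) = (fun x =>
    (Cre (f x ord0 ord0) ^+ 2 + Cim (f x ord0 ord0) ^+ 2) +
    (Cre (f x (lift ord0 ord0) ord0) ^+ 2 + Cim (f x (lift ord0 ord0) ord0) ^+ 2))).
  2: by apply/funext => x; rewrite sqnormC2E !sqr_cabs.
by apply: measurable_funD; apply: measurable_funD; apply: measurable_funX.
Qed.

Lemma mvec_sqnormE f : mvec f -> measurable_fun I (fun x => (sqnormC2 (f x))%:E).
Proof. by move=> /mvec_sqnorm h; exact/measurable_EFinP. Qed.

Lemma mvecD f g : mvec f -> mvec g -> mvec (fun x => f x + g x).
Proof.
move=> [f1 f2] [g1 g2]; split => j.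
  rewrite (_ : (fun x => _) = (fun x => Cre (f x j ord0) + Cre (g x j ord0))).
    exact: measurable_funD.
  by apply/funext => x; rewrite mxE ReD.
rewrite (_ : (fun x => _) = (fun x => Cim (f x j ord0) + Cim (g x j ord0))).
  exact: measurable_funD.
by apply/funext => x; rewrite mxE ImD.
Qed.

Lemma mvecZ (c : R -> R[i]) f : measurable_fun I (fun x => Cre (c x)) ->
  measurable_fun I (fun x => Cim (c x)) -> mvec f -> mvec (fun x => c x *: f x).
Proof.
move=> c1 c2 [f1 f2]; split => j.
  rewrite (_ : (fun x => _) = (fun x => Cre (c x) * Cre (f x j ord0) -
      Cim (c x) * Cim (f x j ord0))).
    by apply: measurable_funB; apply: measurable_funM.
  by apply/funext => x; rewrite mxE ReM.
rewrite (_ : (fun x => _) = (fun x => Cre (c x) * Cim (f x j ord0) +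
    Cim (c x) * Cre (f x j ord0))).
  by apply: measurable_funD; apply: measurable_funM.
by apply/funext => x; rewrite mxE ImM.
Qed.

Lemma mvecZc (c : R[i]) f : mvec f -> mvec (fun x => c *: f x).
Proof. by move=> h; apply: mvecZ => //; exact: measurable_cst. Qed.

Lemma mvecB f g : mvec f -> mvec g -> mvec (fun x => f x - g x).
Proof.
move=> hf /(mvecZc (-1)) /(mvecD hf).
by under eq_fun do rewrite scaleN1r.
Qed.

Lemma sqint_le f g : mvec f -> mvec g ->
  (forall x, 0 <= x <= pi -> sqnormC2 (f x) <= sqnormC2 (g x)) -> (sqint f <= sqint g)%E.
Proof.
move=> mf mg h; apply: ge0_le_integral => //.
- by move=> x _; rewrite lee_fin sqnormC2_ge0.
- exact: mvec_sqnormE.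
- exact: mvec_sqnormE.
Qed.

Lemma sqint_ge0 f : (0 <= sqint f)%E.
Proof. by apply: integral_ge0 => x _; rewrite lee_fin sqnormC2_ge0. Qed.

Lemma sqintZ (c : R[i]) f : mvec f ->
  sqint (fun x => c *: f x) = ((cabs c ^+ 2)%:E * sqint f)%E.
Proof.
move=> mf; rewrite /sqint; under eq_integral do rewrite sqnormC2Z EFinM.
rewrite ge0_integralZl//.
- exact: mvec_sqnormE.
- by move=> x _; rewrite lee_fin sqnormC2_ge0.
- by rewrite lee_fin sqr_ge0.
Qed.

Lemma sqintD f g : mvec f -> mvec g ->
  (sqint (fun x => (f x + g x)%R) <= 2%:E * sqint f + 2%:E * sqint g)%E.
Proof.
move=> mf mg; rewrite /sqint -!ge0_integralZl//; last 4 first.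
- exact: mvec_sqnormE.
- by move=> x _; rewrite lee_fin sqnormC2_ge0.
- exact: mvec_sqnormE.
- by move=> x _; rewrite lee_fin sqnormC2_ge0.
have m2 h : mvec h -> measurable_fun I (fun x => (2%:E * (sqnormC2 (h x))%:E)%E).
  by move=> mh; apply: measurable_funeM; exact: mvec_sqnormE.
rewrite -ge0_integralD//; last 4 first.
- by move=> x _; rewrite -EFinM lee_fin mulr_ge0 ?sqnormC2_ge0.
- exact: m2.
- by move=> x _; rewrite -EFinM lee_fin mulr_ge0 ?sqnormC2_ge0.
- exact: m2.
apply: ge0_le_integral => //.
- by move=> x _; rewrite lee_fin sqnormC2_ge0.
- by apply: mvec_sqnormE; exact: mvecD.
- by apply: emeasurable_funD; exact: m2.
- by move=> x _; rewrite -!EFinM -EFinD lee_fin sqnormC2D.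
Qed.

Lemma L2norm_lty f : (L2norm f < +oo)%E <-> (sqint f < +oo)%E.
Proof.
split; first by apply: lty_poweRy; rewrite invr_neq0.
exact: poweR_lty.
Qed.

Lemma L2norm_ltE f e : 0 < e -> (L2norm f < e%:E)%E <-> (sqint f < (e ^+ 2)%:E)%E.
Proof.
move=> e0; rewrite /L2norm -/(sqint f).
have := sqint_ge0 f; case: (sqint f) => [r||]//; last first.
  by move=> _; rewrite poweRyr ?invr_neq0//; split; rewrite ltNge leey.
rewrite lee_fin => r0; rewrite poweR_EFin !lte_fin powR12_sqrt//.
split=> [h|h].
  by rewrite -(sqr_sqrtr r0) ltr_pXn2r ?nnegrE ?sqrtr_ge0 ?ltW.
by rewrite -[e](ger0_norm (ltW e0)) -sqrtr_sqr ltr_sqrt// exprn_gt0.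
Qed.

Lemma L2E f : L2 f <-> mvec f /\ (sqint f < +oo)%E.
Proof.
split=> [[h1 [h2 /L2norm_lty h3]]|[[h1 h2] h3]]; first by [].
by split=> //; split=> //; exact/L2norm_lty.
Qed.

Lemma lebesgue_measure_0pi : mu I = pi%:E.
Proof. by rewrite lebesgue_measure_itv/= lte_fin pi_gt0 oppr0 adde0. Qed.

Lemma mvec_bounded_L2 f (C : R) : mvec f ->
  (forall x, 0 <= x <= pi -> sqnormC2 (f x) <= C) -> L2 f.
Proof.
move=> mf hC; apply/L2E; split=> //.
apply: (@le_lt_trans _ _ (\int[mu]_(x in I) C%:E)%E).
  apply: ge0_le_integral => //.
  - by move=> x _; rewrite lee_fin sqnormC2_ge0.
  - exact: mvec_sqnormE.
by rewrite integral_cst//= lebesgue_measure_0pi -EFinM ltry.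
Qed.

Lemma L2D f g : L2 f -> L2 g -> L2 (fun x => f x + g x).
Proof.
move=> /L2E[mf ff] /L2E[mg fg]; apply/L2E; split; first exact: mvecD.
rewrite (le_lt_trans (sqintD mf mg))// lte_add_pinfty// lte_mul_pinfty//;
  by rewrite ?lee_fin.
Qed.

Lemma L2Z (c : R[i]) f : L2 f -> L2 (fun x => c *: f x).
Proof.
move=> /L2E[mf ff]; apply/L2E; split; first exact: mvecZc.
by rewrite sqintZ// lte_mul_pinfty// lee_fin sqr_ge0.
Qed.

End square_norm.

(** * Closed linear spans *)

Section linear_span.
Context {K : nzRingType} {V : lmodType K} {J : choiceType}.
Variables (v : J -> V) (D : set J).

Lemma lin_spanP g : lin_span v D g <->
  exists2 l : seq (J * K), (forall p, p \in l -> D p.1) & g = \sum_(p <- l) p.2 *: v p.1.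
Proof.
split=> [[s [c [sD ->]]]|[l lD ->]].
  exists [seq (i, c i) | i <- s]; first by move=> _ /mapP[i si ->]; exact: sD.
  by rewrite big_map.
exists (undup [seq p.1 | p <- l]), (fun i => \sum_(p <- l | p.1 == i) p.2); split.
  by move=> i /=; rewrite mem_undup => /mapP[p pl ->]; exact: lD.
under [RHS]eq_bigr do rewrite scaler_suml big_mkcond.
rewrite [RHS]exchange_big/= big_seq [RHS]big_seq; apply: eq_bigr => p pl.
rewrite [RHS](bigD1_seq p.1) ?undup_uniq ?mem_undup ?map_f//= eqxx big1 ?addr0//.
by move=> i /negPf; rewrite eq_sym => ->.
Qed.

Lemma lin_span0 : lin_span v D 0.
Proof. by apply/lin_spanP; exists [::]; rewrite ?big_nil. Qed.

Lemma lin_spanD f g : lin_span v D f -> lin_span v D g -> lin_span v D (f + g).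
Proof.
move=> /lin_spanP[l lD ->] /lin_spanP[l' lD' ->]; apply/lin_spanP.
exists (l ++ l'); last by rewrite big_cat.
by move=> p; rewrite mem_cat => /orP[/lD|/lD'].
Qed.

Lemma lin_spanZ c g : lin_span v D g -> lin_span v D (c *: g).
Proof.
move=> /lin_spanP[l lD ->]; apply/lin_spanP.
exists [seq (p.1, c * p.2) | p <- l]; first by move=> _ /mapP[p pl ->] /=; exact: lD pl.
by rewrite big_map scaler_sumr; apply: eq_bigr => p _; rewrite scalerA.
Qed.

Lemma lin_span_gen i : D i -> lin_span v D (v i).
Proof.
move=> Di; apply/lin_spanP; exists [:: (i, 1)]; last by rewrite big_seq1 scale1r.
by move=> p; rewrite inE => /eqP ->.
Qed.

End linear_span.

Section closure.
Context {R : realType} {J : choiceType}.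
Variables (ph : J -> R -> 'cV[R[i]]_2) (D : set J).
Hypothesis L2ph : system_in L2 ph D.
Implicit Types f g : R -> 'cV[R[i]]_2.

Notation I := (`[0, pi : R]%classic).
Notation mu := (@lebesgue_measure R).
Notation clos := (closed_lin_span L2 L2norm ph D).

Lemma L2_0 : L2 (0 : R -> 'cV[R[i]]_2).
Proof.
apply: (@mvec_bounded_L2 _ _ 0) => [|x _]; last by rewrite sqnormC2_0.
split => j.
  rewrite (_ : (fun x => _) = cst 0); first exact: measurable_cst.
  by apply/funext => x; rewrite mxE.
rewrite (_ : (fun x => _) = cst 0); first exact: measurable_cst.
by apply/funext => x; rewrite mxE.
Qed.

Lemma lin_span_L2 g : lin_span ph D g -> L2 g.
Proof.
move=> /lin_spanP[l lD ->]; elim: l lD => [|p l ih] lD.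
  by rewrite big_nil; exact: L2_0.
rewrite big_cons; apply: L2D.
  by apply: L2Z; apply: L2ph; apply: lD; rewrite mem_head.
by apply: ih => q ql; apply: lD; rewrite in_cons ql orbT.
Qed.

(** With the square norm, the triangle inequality can be replaced by the
    elementary [sqnormC2D]. *)
Lemma closP f : clos f <-> L2 f /\
  forall e, 0 < e -> exists2 g, lin_span ph D g & (sqint (fun x => f x - g x)%R < e%:E)%E.
Proof.
split=> -[Lf h]; split=> // e e0.
  have se0 : 0 < Num.sqrt e by rewrite sqrtr_gt0.
  have [g sg fg] := h _ se0; exists g => //.
  by have /(L2norm_ltE _ se0) := fg; rewrite sqr_sqrtr ?(ltW e0).
have e20 : 0 < e ^+ 2 by rewrite exprn_gt0.
by have [g sg fg] := h _ e20; exists g => //; exact/(L2norm_ltE _ e0).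
Qed.

Lemma L2_mvec f : L2 f -> mvec f. Proof. by move=> /L2E[]. Qed.

Lemma clos_L2 f : clos f -> L2 f. Proof. by case. Qed.

Lemma clos_span g : lin_span ph D g -> clos g.
Proof.
move=> sg; apply/closP; split=> [|e e0]; first exact: lin_span_L2.
exists g => //; rewrite /sqint.
under eq_integral do rewrite subrr sqnormC2_0.
by rewrite integral0 lte_fin.
Qed.

Lemma sqintD_lt f g h e1 e2 : mvec f -> mvec g -> mvec h ->
  (sqint (fun x => f x - g x)%R < e1%:E)%E -> (sqint (fun x => g x - h x)%R < e2%:E)%E ->
  (sqint (fun x => f x - h x)%R < (2 * e1 + 2 * e2)%:E)%E.
Proof.
move=> mf mg mh h1 h2.
have -> : (fun x => f x - h x) = (fun x => (f x - g x) + (g x - h x)).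
  by apply/funext => x; rewrite addrA subrK.
apply: (le_lt_trans (sqintD (mvecB mf mg) (mvecB mg mh))).
have -> : ((2 * e1 + 2 * e2)%:E = 2%:E * e1%:E + 2%:E * e2%:E)%E by [].
by rewrite lteD// lte_pmul2l// lte_fin.
Qed.

Lemma clos_lim f : L2 f ->
  (forall e, 0 < e -> exists2 g, clos g & (sqint (fun x => f x - g x)%R < e%:E)%E) -> clos f.
Proof.
move=> Lf h; apply/closP; split=> // e e0.
have e40 : 0 < e / 4 by rewrite divr_gt0.
have [g /closP[Lg hg] fg] := h _ e40; have [k sk gk] := hg _ e40.
exists k => //; have -> : e = 2 * (e / 4) + 2 * (e / 4) by lra.
apply: (sqintD_lt _ _ _ fg gk); apply: L2_mvec => //; exact: lin_span_L2.
Qed.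

Lemma closD f g : clos f -> clos g -> clos (fun x => f x + g x).
Proof.
move=> /closP[Lf hf] /closP[Lg hg]; apply/closP; split=> [|e e0]; first exact: L2D.
have e40 : 0 < e / 4 by rewrite divr_gt0.
have [f' sf ff] := hf _ e40; have [g' sg gg] := hg _ e40.
exists (f' + g'); first exact: lin_spanD.
have mf := L2_mvec (lin_span_L2 sf); have mg := L2_mvec (lin_span_L2 sg).
have -> : (fun x => f x + g x - (f' + g') x) = (fun x => (f x - f' x) + (g x - g' x)).
  by apply/funext => x; rewrite [(f' + g') x]/(f' x + g' x) opprD addrACA.
apply: (le_lt_trans (sqintD _ _)); [exact: mvecB (L2_mvec Lf) mf|exact: mvecB (L2_mvec Lg) mg|].
have -> : (e%:E = 2%:E * (e / 4)%:E + 2%:E * (e / 4)%:E)%E.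
  by rewrite -!EFinM -EFinD; congr EFin; lra.
by rewrite lteD// lte_pmul2l// lte_fin.
Qed.

Lemma closZ (c : R[i]) f : clos f -> clos (fun x => c *: f x).
Proof.
move=> /closP[Lf hf]; apply/closP; split=> [|e e0]; first exact: L2Z.
have c0 : 0 < cabs c ^+ 2 + 1 by rewrite ltr_wpDl// sqr_ge0.
have e10 : 0 < e / (cabs c ^+ 2 + 1) by rewrite divr_gt0.
have [g sg fg] := hf _ e10; exists (c *: g); first exact: lin_spanZ.
have mg := L2_mvec (lin_span_L2 sg).
have -> : (fun x => c *: f x - (c *: g) x) = (fun x => c *: (f x - g x)).
  by apply/funext => x; rewrite scalerBr.
rewrite sqintZ; last exact: mvecB (L2_mvec Lf) mg.
apply: (@le_lt_trans _ _ ((cabs c ^+ 2 + 1)%:E * sqint (fun x => f x - g x)%R)%E).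
  by rewrite lee_pmul// ?lee_fin ?sqr_ge0 ?sqint_ge0// lerDl.
by rewrite -lte_pdivlMl// -EFinM mulrC.
Qed.

Lemma closB f g : clos f -> clos g -> clos (fun x => f x - g x).
Proof.
move=> cf /(closZ (-1))/(closD cf).
by under eq_fun do rewrite scaleN1r.
Qed.

Lemma clos_lim_unif f : L2 f ->
  (forall e, 0 < e -> exists2 g, clos g &
     forall x, 0 <= x <= pi -> sqnormC2 (f x - g x) <= e) -> clos f.
Proof.
move=> Lf h; apply: clos_lim => // e e0.
have e10 : 0 < e / (2 * pi) by rewrite divr_gt0 ?mulr_gt0 ?pi_gt0.
have [g cg fg] := h _ e10; exists g => //.
apply: (@le_lt_trans _ _ (\int[mu]_(x in I) (e / (2 * pi))%:E)%E).
  apply: ge0_le_integral => //.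
  - by move=> x _; rewrite lee_fin sqnormC2_ge0.
  - by apply: mvec_sqnormE; exact: mvecB (L2_mvec Lf) (L2_mvec (clos_L2 cg)).
rewrite integral_cst//= lebesgue_measure_0pi -EFinM lte_fin.
rewrite (_ : e / (2 * pi) * pi = e / 2); last by rewrite invfM mulrA mulfVK// lt0r_neq0// pi_gt0.
by lra.
Qed.

Lemma eq_clos f g : (forall x, 0 <= x <= pi -> f x = g x) -> L2 f -> clos g -> clos f.
Proof.
move=> fg Lf cg; apply: clos_lim_unif => // e e0; exists g => // x xp.
by rewrite fg// subrr sqnormC2_0 ltW.
Qed.

(** An error bounded by [C] on an interval of length [e] and vanishing elsewhere
    is at most [C * e] in square norm. *)
Lemma clos_lim_local f (C : R) : L2 f ->
  (forall e, 0 < e -> exists g (x0 : R), clos g /\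
     forall x, 0 <= x <= pi ->
       sqnormC2 (f x - g x) <= if x0 <= x <= x0 + e then C else 0) -> clos f.
Proof.
move=> Lf h; apply: clos_lim => // e e0.
have C0 : 0 < `|C| + 1 by rewrite ltr_wpDl.
have e10 : 0 < e / (2 * (`|C| + 1)) by rewrite divr_gt0 ?mulr_gt0.
have [g [x0 [cg fg]]] := h _ e10; exists g => //.
set d := e / _ in fg e10.
pose A : set R := `[x0, x0 + d]%classic.
apply: (@le_lt_trans _ _ (\int[mu]_(x in I) ((`|C| + 1)%:E * (\1_A x)%:E))%E).
  apply: ge0_le_integral => //.
  - by move=> x _; rewrite lee_fin sqnormC2_ge0.
  - by apply: mvec_sqnormE; exact: mvecB (L2_mvec Lf) (L2_mvec (clos_L2 cg)).
  - apply: measurable_funeM; apply/measurable_EFinP.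
    by apply: measurable_indic; exact: measurable_itv.
  - move=> x; rewrite /= in_itv/= => /fg h1; rewrite -EFinM lee_fin (le_trans h1)//.
    rewrite indicE /A mem_setE in_itv/=; case: ifP => _; rewrite ?mulr1 ?mulr0//.
    by rewrite (le_trans (ler_norm C))// lerDl.
rewrite ge0_integralZl//; last first.
  by apply/measurable_EFinP/measurable_indic; exact: measurable_itv.
rewrite integral_indic//; last exact: measurable_itv.
apply: (@le_lt_trans _ _ ((`|C| + 1)%:E * mu A)%E).
  rewrite lee_pmul2l ?lte_fin//=.
  apply: le_measure; rewrite ?inE; last exact: subIsetl.
    by apply: measurableI; exact: measurable_itv.
  exact: measurable_itv.
rewrite lebesgue_measure_itv/= lte_fin ltrDl e10 -EFinD -EFinM lte_fin.
rewrite (_ : (`|C| + 1) * (x0 + d - x0) = e / 2); first by lra.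
by rewrite /d; field; lra.
Qed.

End closure.

(** * From intervals to square integrable functions *)

Section density.
Context {R : realType} {J : choiceType}.
Variables (ph : J -> R -> 'cV[R[i]]_2) (D : set J).
Hypothesis L2ph : system_in L2 ph D.

Notation J0pi := (`[0, pi : R]%classic).
Notation mu := (@lebesgue_measure R).
Notation clos := (closed_lin_span L2 L2norm ph D).

Variables (e : R -> 'cV[R[i]]_2) (C : R).
Hypothesis me : mvec e.
Hypothesis be : forall x, 0 <= x <= pi -> sqnormC2 (e x) <= C.

Let smul (p : R -> R) x := (p x)%:C *: e x.

Let C_ge0 : 0 <= C.
Proof. by apply: le_trans (be (x := 0) _); rewrite ?sqnormC2_ge0// lexx pi_ge0. Qed.

Definition sq_integrable (p : R -> R) :=
  measurable_fun J0pi p /\ (\int[mu]_(x in J0pi) (p x ^+ 2)%:E < +oo)%E.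

Lemma le_sq_integrable (p q : R -> R) : measurable_fun J0pi p -> sq_integrable q ->
  (forall x, 0 <= x <= pi -> `|p x| <= `|q x|) -> sq_integrable p.
Proof.
move=> mp [mq fq] pq; split=> //; apply: le_lt_trans fq.
apply: ge0_le_integral => //.
- by move=> x _; rewrite lee_fin sqr_ge0.
- by apply/measurable_EFinP/measurable_funX.
- by apply/measurable_EFinP/measurable_funX.
- move=> x; rewrite /= in_itv/= => /pq h.
  by rewrite lee_fin -(real_normK (num_real (p x))) -(real_normK (num_real (q x)))
    ler_pXn2r ?nnegrE.
Qed.

Let mvec_smul (p : R -> R) : measurable_fun J0pi p -> mvec (smul p).
Proof. by move=> mp; apply: mvecZ => //=; exact: measurable_cst. Qed.

Let sqnorm_smul (p : R -> R) (x : R) : 0 <= x <= pi -> sqnormC2 (smul p x) <= C * p x ^+ 2.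
Proof.
move=> xp; rewrite /smul sqnormC2Z cabs_real real_normK ?num_real// mulrC.
by rewrite ler_wpM2r ?sqr_ge0// be.
Qed.

Let L2_smul (p : R -> R) : sq_integrable p -> L2 (smul p).
Proof.
move=> [mp fp]; apply/L2E; split; first exact: mvec_smul.
apply: (@le_lt_trans _ _ (\int[mu]_(x in J0pi) (C%:E * (p x ^+ 2)%:E))%E).
  apply: ge0_le_integral => //.
  - by move=> x _; rewrite lee_fin sqnormC2_ge0.
  - by apply: mvec_sqnormE; exact: mvec_smul.
  - by apply: measurable_funeM; apply/measurable_EFinP/measurable_funX.
  - by move=> x; rewrite /= in_itv/= => /sqnorm_smul; rewrite -EFinM lee_fin.
rewrite ge0_integralZl//.
- by rewrite lte_mul_pinfty// lee_fin.
- by apply/measurable_EFinP/measurable_funX.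
- by move=> x _; rewrite lee_fin sqr_ge0.
Qed.

Let clos_smul_lim (p : R -> R) (pn : nat -> R -> R) : sq_integrable p ->
  (forall n, measurable_fun J0pi (pn n)) -> (forall n, clos (smul (pn n))) ->
  (forall n (x : R), 0 <= x <= pi -> 0 <= pn n x <= p x) ->
  (forall x : R, 0 <= x <= pi -> pn ^~ x @ \oo --> p x) -> clos (smul p).
Proof.
move=> sp mpn cpn pnp pnl; have [mp fp] := sp.
apply: clos_lim => //; first exact: L2_smul.
move=> r r0.
pose F n x : \bar R := (C * (p x - pn n x) ^+ 2)%:E.
have mF n : measurable_fun J0pi (F n).
  apply/measurable_EFinP/measurable_funM; first exact: measurable_cst.
  by apply/measurable_funX/measurable_funB.
have H : [sequence (\int[mu]_(x in J0pi) F n x)%E]_n @ \oo --> (0 : \bar R)%E.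
  have [||| _ _] := @dominated_convergence _ _ _ mu J0pi (measurable_itv _) F (cst 0%E)
    (fun x => (C * p x ^+ 2)%:E) mF (measurable_cst _).
  - apply: aeW => x; rewrite /= in_itv/= => xp.
    apply: cvg_EFin; first by apply: nearW.
    rewrite /comp/= [X in _ --> X](_ : _ = C * (p x - p x) * (p x - p x)); last first.
      by rewrite subrr mulr0.
    under eq_fun do rewrite expr2 mulrA.
    apply: cvgM; [apply: cvgM; first exact: cvg_cst|]; apply: cvgB;
      (exact: cvg_cst || exact: pnl).
  - apply/integrableP; split.
      apply/measurable_EFinP/measurable_funM; first exact: measurable_cst.
      exact: measurable_funX.
    rewrite [ltLHS](_ : _ = (\int[mu]_(x in J0pi) (C%:E * (p x ^+ 2)%:E))%E); last first.
      by apply: eq_integral => x _; rewrite EFinM gee0_abs// -EFinM lee_fin mulr_ge0// sqr_ge0.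
    rewrite ge0_integralZl//.
    + by rewrite lte_mul_pinfty// lee_fin.
    + by apply/measurable_EFinP/measurable_funX.
    + by move=> x _; rewrite lee_fin sqr_ge0.
  - apply: aeW => x n; rewrite /= in_itv/= => /(pnp n) /andP[h1 h2].
    rewrite lee_fin ger0_norm ?(mulr_ge0 C_ge0 (sqr_ge0 _))// ler_wpM2l//.
    rewrite ler_pXn2r ?nnegrE ?subr_ge0//; last exact: le_trans h2.
    by rewrite lerBlDr lerDl.
  by rewrite (_ : (\int[mu]_(x in J0pi) (cst 0%E) x)%E = 0%E); last exact: integral0.
have /fine_cvgP[fin /cvgrPdist_lt /(_ r r0) lim] := H.
have [n [finn limn]] : exists n, (\int[mu]_(x in J0pi) F n x)%E \is a fin_num /\
    `|0 - fine (\int[mu]_(x in J0pi) F n x)%E| < r.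
  by near \oo => n; exists n; split; near: n.
exists (smul (pn n)) => //.
apply: (@le_lt_trans _ _ (\int[mu]_(x in J0pi) F n x)%E).
  apply: ge0_le_integral => //.
  - by move=> x _; rewrite lee_fin sqnormC2_ge0.
  - by apply: mvec_sqnormE; apply: mvecB; exact: mvec_smul.
  - exact: mF.
  - move=> x; rewrite /= in_itv/= => xp; rewrite lee_fin.
    have -> : smul p x - smul (pn n) x = smul (fun x => p x - pn n x) x.
      by rewrite /smul -scalerBl rmorphB.
    exact: sqnorm_smul.
rewrite -(fineK finn) lte_fin; move: limn; rewrite sub0r normrN.
by apply: le_lt_trans; exact: ler_norm.
Unshelve. all: by end_near. Qed.

Hypothesis ce : clos e.
Hypothesis ce_step : forall x0, 0 < x0 < pi ->
  clos (fun x => (if x0 <= x then 1 else 0) *: e x).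

Let sq_integrable_indic A : measurable A -> sq_integrable (\1_A).
Proof.
move=> mA; apply: (@le_sq_integrable _ (cst 1)).
- exact: measurable_indic.
- split; first exact: measurable_cst.
  under eq_integral do rewrite expr1n.
  by rewrite integral_cst//= lebesgue_measure_0pi mul1e ltry.
- by move=> x _; rewrite normr1 indicE; case: (_ \in _); rewrite ?normr1 ?normr0.
Qed.

Let smul_indic0 A : measurable A -> (forall x, 0 <= x < pi -> ~ A x) ->
  clos (smul \1_A).
Proof.
move=> mA A0; apply: (@clos_lim_local _ _ _ _ L2ph _ C) => [|r r0].
  exact/L2_smul/sq_integrable_indic.
exists 0, pi; split; first by apply: clos_span => //; exact: lin_span0.
move=> x /andP[x0 xp]; rewrite subr0.
have [xltp|pix] := ltP x pi; last first.
  apply: (le_trans (sqnorm_smul _ _)); first by rewrite x0.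
  have -> /= : x <= pi + r by rewrite (le_trans xp)// lerDl ltW.
  rewrite indicE.
  by case: (_ \in _); rewrite ?expr1n ?mulr1// expr0n mulr0.
rewrite /smul indicE memNset; last by apply: A0; rewrite x0.
by rewrite scale0r sqnormC2_0.
Qed.

Let clos_indic_ray x0 : clos (smul \1_(`[x0, +oo[%classic : set R)).
Proof.
have mr : measurable (`[x0, +oo[%classic : set R) by exact: measurable_itv.
have [x00|x00] := leP x0 0.
  apply: (eq_clos L2ph _ _ ce); last exact/L2_smul/sq_integrable_indic.
  move=> x /andP[xge0 _]; rewrite /smul indicE mem_set ?scale1r//=.
  by rewrite in_itv/= (le_trans x00).
have [x0p|x0p] := leP pi x0.
  apply: smul_indic0 => // x /andP[_ xp]; rewrite /= in_itv/= andbT.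
  by apply/negP; rewrite -ltNge (lt_le_trans xp).
apply: (eq_clos L2ph _ _ (ce_step (x0 := x0) _)); last by rewrite x00.
  move=> x _; rewrite /smul indicE mem_setE in_itv/= andbT.
  by case: ifP.
exact/L2_smul/sq_integrable_indic.
Qed.

(** The sets whose indicator multiplied by [e] is in the closed span form a
    Dynkin system, and the rays generate the Borel sets. *)
Let clos_indic A : measurable A -> clos (smul \1_A).
Proof.
move=> mA; have mE := @RGenCInfty.measurableE R.
suff H : forall S, <<s (@RGenCInfty.G R) >> S -> clos (smul \1_S).
  by apply: H; move: mA; rewrite [X in X A -> _]mE.
pose P (S : set R) := clos (smul \1_S).
apply: (@dynkin_induction _ (measurableTypeR R) (@RGenCInfty.G R) P mE).
- move=> _ _ [x ->] [y ->]; exists (Num.max x y).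
  apply/seteqP; split => z /=; rewrite !in_itv/= !andbT ge_max.
    by case=> -> ->.
  by move/andP.
- apply: (eq_clos L2ph _ _ ce); last exact/L2_smul/sq_integrable_indic.
  by move=> x _; rewrite /smul indicT scale1r.
- by move=> _ [x ->]; exact: clos_indic_ray.
- move=> S mS cS; apply: (eq_clos L2ph _ _ (closB L2ph ce cS)).
    move=> x _; rewrite /smul indicC indicE; case: (x \in S) => /=.
      by rewrite scale1r scale0r subrr.
    by rewrite scale1r scale0r subr0.
  exact/L2_smul/sq_integrable_indic/measurableC.
- move=> F mF tF cF.
  have mU n : measurable (\big[setU/set0]_(i < n) F i : set R).
    by apply: bigsetU_measurable => i _; exact: mF.
  apply: (@clos_smul_lim _ (fun n => \1_(\big[setU/set0]_(i < n) F i))).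
  + by apply: sq_integrable_indic; apply: bigcup_measurable => k _; exact: mF.
  + by move=> n; exact: measurable_indic.
  + elim=> [|n ih].
      by rewrite big_ord0; apply: smul_indic0 => // x _ [].
    apply: (eq_clos L2ph _ _ (closD L2ph ih (cF n))).
      move=> x _; rewrite /smul -scalerDl -rmorphD big_ord_recr/=; congr (_%:C *: _).
      rewrite !indicE in_setU; case: (boolP (x \in F n)) => xF; last first.
        by rewrite orbF addr0.
      have -> : x \in \big[setU/set0]_(i < n) F i = false.
        apply/negP; rewrite inE => xn; move: xF; rewrite inE => xF.
        move: xn; rewrite -bigcup_mkord => -[k /= kn Fk].
        by move: kn; rewrite (tF k n I I (ex_intro _ x (conj Fk xF))) ltnn.
      by rewrite /= add0r.
    exact/L2_smul/sq_integrable_indic.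
  + move=> n x _; rewrite !indicE ler0n ler_nat.
    case: (boolP (x \in \big[setU/set0]_(i < n) F i)) => //.
    rewrite inE -bigcup_mkord => -[i _ Fx].
    by rewrite (_ : x \in _)// inE; exists i.
  + move=> x _; have [[k _ Fk]|nF] := pselect ((\bigcup_k F k) x).
      apply: (@cvg_trans _ ((cst 1 : nat -> R) @ \oo)).
        apply: near_eq_cvg; near=> n.
        rewrite indicE mem_set// -bigcup_mkord; exists k => //=.
        by near: n; exists k.+1.
      by rewrite indicE mem_set; [exact: cvg_cst|exists k].
    rewrite indicE memNset//.
    rewrite (_ : (fun _ => _) = cst 0); first exact: cvg_cst.
    apply/funext => n; rewrite indicE memNset// -bigcup_mkord => -[k _ Fk].
    by apply: nF; exists k.
Unshelve. all: by end_near. Qed.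

Import HBNNSimple.

Let clos_nonneg (p : R -> R) : sq_integrable p ->
  (forall x, 0 <= x <= pi -> 0 <= p x) -> clos (smul p).
Proof.
move=> sp p0; have mp : measurable_fun J0pi (EFin \o p) by apply/measurable_EFinP; case: sp.
have mI : measurable J0pi by exact: measurable_itv.
have p0' x : J0pi x -> (0 <= (EFin \o p) x)%E.
  by rewrite /= in_itv/= lee_fin => /p0.
pose q := nnsfun_approx mI mp.
pose qn (n : nat) (x : R) : R := q n x.
apply: (@clos_smul_lim p qn sp).
- by move=> n; apply: measurable_funTS; exact: measurable_funP.
- move=> n.
  have fr : finite_set (range (q n)) by exact: fimfunP.
  have -> : smul (qn n) = (fun x => \sum_(r <- finmap.enum_fset (fset_set (range (q n))))
      r%:C *: smul \1_((q n) @^-1` [set r]) x).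
    apply/funext => x; rewrite /smul /qn {1}fimfunE fsbig_finite//= rmorph_sum scaler_suml.
    by apply: eq_bigr => r _; rewrite rmorphM scalerA.
  elim: (finmap.enum_fset _) => [|r s ih].
    under eq_fun do rewrite big_nil.
    by apply: clos_span => //; exact: lin_span0.
  under eq_fun do rewrite big_cons.
  have mr : measurable ((q n) @^-1` [set r]).
    by apply: measurable_funPTI; exact: measurable_set1.
  exact: (closD L2ph (closZ L2ph r%:C (clos_indic mr)) ih).
- move=> n x xp; rewrite /qn fun_ge0/= -lee_fin /q nnsfun_approxE.
  by apply: le_approx => //; rewrite /= in_itv.
- move=> x xp; have /fine_cvgP[_] := cvg_nnsfun_approx mI mp p0' (x := x) xp.
  exact.
Qed.

(** Positive and negative parts are increasing limits of simple functions, to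
    which dominated convergence applies. *)
Lemma clos_real (p : R -> R) : sq_integrable p -> clos (fun x => (p x)%:C *: e x).
Proof.
move=> sp; have [mp _] := sp.
pose p1 x := Num.max (p x) 0; pose p2 x := Num.max (- p x) 0.
have c1 : clos (smul p1).
  apply: clos_nonneg => [|x _]; last by rewrite le_max lexx orbT.
  apply: le_sq_integrable sp _ => [|x _].
    by apply: measurable_maxr => //; exact: measurable_cst.
  by rewrite /p1; case: (leP (p x) 0) => _; rewrite ?normr0.
have c2 : clos (smul p2).
  apply: clos_nonneg => [|x _]; last by rewrite le_max lexx orbT.
  apply: le_sq_integrable sp _ => [|x _].
    by apply: measurable_maxr; [exact: measurable_funN|exact: measurable_cst].
  by rewrite /p2; case: (leP (- p x) 0) => _; rewrite ?normr0 ?normrN.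
have -> : (fun x => (p x)%:C *: e x) = (fun x => smul p1 x - smul p2 x).
  apply/funext => x; rewrite /smul -scalerBl -rmorphB; congr (_%:C *: _).
  by rewrite /p1 /p2; case: (leP (p x) 0) => h1; case: (leP (- p x) 0) => h2; lra.
exact: (closB L2ph c1 c2).
Qed.

Lemma clos_complex (c : R -> R[i]) : sq_integrable (fun x => Cre (c x)) ->
  sq_integrable (fun x => Cim (c x)) -> clos (fun x => c x *: e x).
Proof.
move=> c1 c2.
have -> : (fun x => c x *: e x) =
    (fun x => (Cre (c x))%:C *: e x + 'i%C *: ((Cim (c x))%:C *: e x)).
  by apply/funext => x; rewrite scalerA -scalerDl -complexE.
exact: (closD L2ph (clos_real c1) (closZ L2ph 'i%C (clos_real c2))).
Qed.

End density.

(** * The system in terms of exponentials *)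

Section continuous_vectors.
Context {R : realType}.
Implicit Types p q : R -> R[i].
Notation J0pi := (`[0, pi : R]%classic).

Definition cmeas p := measurable_fun J0pi (fun x => Cre (p x)) /\
  measurable_fun J0pi (fun x => Cim (p x)).

Lemma ccont_cmeas p : ccont p -> cmeas p.
Proof.
move=> [h1 h2]; split; apply: measurable_funTS;
  apply: continuous_measurable_fun; [exact: h1|exact: h2].
Qed.

Lemma mvec_vec2 p q : cmeas p -> cmeas q -> mvec (vec2 p q).
Proof.
move=> [p1 p2] [q1 q2]; split => j.
  rewrite (_ : (fun x => _) = if j == ord0 then (fun x => Cre (p x)) else (fun x => Cre (q x))).
    by case: ifP.
  by apply/funext => x; rewrite mxE; case: ifP.
rewrite (_ : (fun x => _) = if j == ord0 then (fun x => Cim (p x)) else (fun x => Cim (q x))).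
  by case: ifP.
by apply/funext => x; rewrite mxE; case: ifP.
Qed.

Lemma L2_vec2 p q (M : R) : cmeas p -> cmeas q ->
  (forall x, 0 <= x <= pi -> cabs (p x) <= M /\ cabs (q x) <= M) -> L2 (vec2 p q).
Proof.
move=> mp mq hM; apply: (@mvec_bounded_L2 _ _ (M ^+ 2 + M ^+ 2)).
  exact: mvec_vec2.
move=> x xp; have [hp hq] := hM x xp; rewrite sqnormC2_vec2.
by rewrite lerD// ler_pXn2r ?nnegrE ?cabs_ge0// (le_trans (cabs_ge0 _) hp).
Qed.

Lemma ccont_L2_vec2 p q : ccont p -> ccont q -> L2 (vec2 p q).
Proof.
move=> cp cq; have [M1 M10 h1] := ccont_bounded 0 pi cp.
have [M2 M20 h2] := ccont_bounded 0 pi cq.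
apply: (@L2_vec2 _ _ (M1 + M2)); [exact: ccont_cmeas|exact: ccont_cmeas|].
move=> x xp; split; first by rewrite (le_trans (h1 x xp))// lerDl ltW.
by rewrite (le_trans (h2 x xp))// lerDr ltW.
Qed.

End continuous_vectors.

Section root_functions.
Context {R : realType}.
Variable a : R[i].
Implicit Types (n m : int) (x : R).

Definition monom (b : bool) n x : R[i] := expC (n%:~R * (branch a b * x%:C)).

Lemma monom_neq0 b n x : monom b n x != 0. Proof. exact: expC_neq0. Qed.

Lemma monomD b n m x : monom b (n + m) x = monom b n x * monom b m x.
Proof. by rewrite /monom intrD mulrDl expCD. Qed.

Lemma monomN b n x : monom b (- n) x = (monom b n x)^-1.
Proof. by rewrite /monom mulrNz mulNr expCN. Qed.

Lemma monom0 b n : monom b n 0 = 1. Proof. by rewrite /monom !mulr0 expC0. Qed.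

Lemma monom_pi n : monom true n pi = monom false n pi.
Proof. exact: expC_intM (expC_branch_pi a). Qed.

Lemma cder_monom b n x : cder (monom b n) (n%:~R * branch a b * monom b n x) x.
Proof.
have -> : monom b n = (fun x => expC (n%:~R * branch a b * x%:C)).
  by apply/funext => t; rewrite /monom mulrA.
exact: cder_expC.
Qed.

Lemma ccont_monom b n : ccont (monom b n).
Proof. by apply: cder_ccont => x; exact: cder_monom. Qed.

Lemma expC_i (t : R) : expC ('i%C * t%:C) = (cos t)%:C + 'i%C * (sin t)%:C.
Proof.
apply/eqP; rewrite /expC eq_complex/=.
by rewrite !(mul0r, mulr0, mul1r, subr0, addr0, add0r, oppr0, expR0) !eqxx.
Qed.

Let i2 : 'i%C ^+ 2 = -1 :> R[i] := sqr_i R.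
Let i_neq0 : 'i%C != 0 :> R[i].
Proof. by rewrite -cabs_gt0 cabs_i. Qed.

Lemma phiE n : phi a n = vec2 (fun x => (monom true n x - monom false n x) / (2 * 'i%C))
  (fun x => 'i%C * n%:~R * monom false n x).
Proof.
apply/funext => x; set t := n%:~R * x.
have tC : t%:C = n%:~R * x%:C by rewrite rmorphM rmorph_int.
set c : R[i] := (cos t)%:C; set s : R[i] := (sin t)%:C.
have csE : c ^+ 2 + s ^+ 2 = 1.
  by rewrite -!rmorphXn -rmorphD cos2Dsin2.
have eT : monom true n x = expC (a * t%:C) * (c + 'i%C * s).
  by rewrite -expC_i -expCD /monom tC; congr expC; rewrite /branch; move: ('i%C : R[i]) => i /=; ring.
have eF : monom false n x = expC (a * t%:C) * (c - 'i%C * s).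
  have -> : c - 'i%C * s = expC ('i%C * (- t)%:C).
    by rewrite expC_i cosN sinN -mulrN; congr (_ + _ * _); exact/esym/rmorphN.
  have tC' : (- t)%:C = - (n%:~R * x%:C) by rewrite -tC; exact: rmorphN.
  by rewrite -expCD /monom tC' tC; congr expC; rewrite /branch; move: ('i%C : R[i]) => i /=; ring.
apply: vec2P; rewrite !mxE/= -/t -/s -/c ?eT eF.
  by field; rewrite i_neq0.
have -> : s + 'i%C * c = 'i%C * (c - 'i%C * s).
  by rewrite mulrBr mulrA -expr2 i2 mulN1r opprK addrC.
ring.
Qed.

Lemma system_in_phi : system_in L2 (phi a) [set n : int | n != 0].
Proof.
move=> n _; rewrite phiE; apply: ccont_L2_vec2.
  have -> : (fun x => (monom true n x - monom false n x) / (2 * 'i%C)) =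
      (fun x => (monom true n x + (- 1) * monom false n x) * (2 * 'i%C)^-1).
    by apply/funext => x; rewrite mulN1r.
  apply: ccontM; last exact: ccont_cst.
  apply: ccontD; first exact: ccont_monom.
  by apply: ccontM; [exact: ccont_cst|exact: ccont_monom].
by apply: ccontM; [exact: ccont_cst|exact: ccont_monom].
Qed.

(** * Minimality *)

Section biorthogonal.
Variable n : int.
Hypothesis n0 : n != 0.

Let nC : (n%:~R : R[i]) != 0. Proof. by rewrite intr_eq0. Qed.

Let u := branch a true.
Let w := branch a false.
Let H x : R[i] := (monom false (- n) x - monom true (- n) x) / n%:~R.

(** The pairing at [x] with the [n]-th biorthogonal function.  The latter comes
    from writing [(expC (pi u z) - expC (pi w z)) / (z - n)], which vanishes at
    the other integers, as an integral over [[0, pi]]; [H] arises in the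
    integration by parts that produces the factor [z] of the second
    component. *)
Let pair x (v : 'cV[R[i]]_2) : R[i] :=
  2 * 'i%C * u * monom true (- n) x * v ord0 ord0 +
  'i%C * w * H x * v (lift ord0 ord0) ord0.

Let prim m x : R[i] :=
  (if m == n then 2 * 'i%C * x%:C
   else (monom true (m - n) x - monom false (m - n) x) / (m - n)%:~R) - H x * monom false m x.

Let cder_H x : cder H (u * monom true (- n) x - w * monom false (- n) x) x.
Proof.
have := cderZ (n%:~R^-1) (cderB (cder_monom false (- n) x) (cder_monom true (- n) x)).
rewrite /H; under eq_fun do rewrite mulrC.
congr cder; rewrite -/u -/w mulrNz; field; exact: nC.
Qed.

Let uw : u - w = 2 * 'i%C.
Proof. by rewrite /u /w /branch; move: ('i%C : R[i]) => i /=; ring. Qed.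

(** The increment over [[0, pi]] of the primitive [prim m] distinguishes [m = n]
    from the other indices, so that the biorthogonality relations need no
    integral. *)
Let cder_prim m x : cder (prim m) (pair x (phi a m x)) x.
Proof.
have d2 := cderM (cder_H x) (cder_monom false m x).
have i2' := i2.
rewrite phiE /pair /prim !mxE/=; have [mn|mn] := eqVneq m n.
  have := cderB (cderZ (2 * 'i%C) (cder_id x)) d2.
  congr cder; rewrite mn -/w /H !monomN.
  have := uw; move: (monom_neq0 true n x) (monom_neq0 false n x) i2' i_neq0 nC.
  move: (monom true n x) (monom false n x) ('i%C : R[i]) (n%:~R) u w => t f i k U W t0 f0 ii i0 k0.
  move=> UW; have -> : U = W + 2 * i by rewrite -UW; ring.
  field : ii.
  by rewrite ?t0 ?f0 ?i0 ?k0.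
have mn0 : ((m - n)%:~R : R[i]) != 0 by rewrite intr_eq0 subr_eq0.
have := cderB (cderZ ((m - n)%:~R^-1) (cderB (cder_monom true (m - n) x) (cder_monom false (m - n) x))) d2.
under eq_fun do rewrite [_^-1 * _]mulrC.
congr cder; rewrite -/w -/u /H !monomD !monomN.
move: (monom_neq0 true n x) (monom_neq0 false n x) i2' i_neq0 nC mn0.
move: (monom true n x) (monom false n x) (monom true m x) (monom false m x) ('i%C : R[i]) (n%:~R)
  (m%:~R) ((m - n)%:~R) u w => t f t' f' i k m' k' U W t0 f0 ii i0 k0 k0'.
field : ii.
by rewrite ?t0 ?f0 ?i0 ?k0 ?k0'.
Qed.

Let H0 : H 0 = 0. Proof. by rewrite /H !monom0 subrr mul0r. Qed.

Let Hpi : H pi = 0. Proof. by rewrite /H monom_pi subrr mul0r. Qed.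

Let prim0 m : prim m 0 = 0.
Proof.
by rewrite /prim H0 !monom0 mul0r subr0 mulr0 subrr mul0r; case: ifP.
Qed.

Let prim_pi m : prim m pi = if m == n then 2 * 'i%C * pi%:C else 0.
Proof.
by rewrite /prim Hpi mul0r subr0; case: ifP => // _; rewrite monom_pi subrr mul0r.
Qed.

Let pair0 x : pair x 0 = 0. Proof. by rewrite /pair !mxE !mulr0 addr0. Qed.

Let pairD x v v' : pair x (v + v') = pair x v + pair x v'.
Proof. by rewrite /pair !mxE; ring. Qed.

Let pairZ x c v : pair x (c *: v) = c * pair x v.
Proof. by rewrite /pair !mxE; ring. Qed.

Let pairB x v v' : pair x (v - v') = pair x v - pair x v'.
Proof. by rewrite /pair !mxE; ring. Qed.

Let ccont_H : ccont H. Proof. exact: cder_ccont cder_H. Qed.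

Let ccont_pair_phi m : ccont (fun x => pair x (phi a m x)).
Proof.
have -> : (fun x => pair x (phi a m x)) = (fun x =>
    (2 * 'i%C * u / (2 * 'i%C)) * monom true (- n) x * (monom true m x + -1 * monom false m x) +
    ('i%C * w) * H x * (('i%C * m%:~R) * monom false m x)).
  by apply/funext => x; rewrite phiE /pair !mxE/=; field; exact: i_neq0.
apply: ccontD; apply: ccontM.
- by apply: ccontM; [exact: ccont_cst|exact: ccont_monom].
- apply: ccontD; first exact: ccont_monom.
  by apply: ccontM; [exact: ccont_cst|exact: ccont_monom].
- by apply: ccontM; [exact: ccont_cst|].
- by apply: ccontM; [exact: ccont_cst|exact: ccont_monom].
Qed.

Let pair_bound : exists2 K, 0 < K & forall x v, 0 <= x <= pi ->
  cabs (pair x v) <= K * (cabs (v ord0 ord0) + cabs (v (lift ord0 ord0) ord0)).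
Proof.
have c1 : ccont (fun x => 2 * 'i%C * u * monom true (- n) x).
  by apply: ccontM; [exact: ccont_cst|exact: ccont_monom].
have c2 : ccont (fun x => 'i%C * w * H x) by apply: ccontM; [exact: ccont_cst|].
have [K1 K10 h1] := ccont_bounded 0 pi c1; have [K2 K20 h2] := ccont_bounded 0 pi c2.
exists (K1 + K2) => [|x v xp]; first by rewrite addr_gt0.
rewrite /pair (le_trans (cabsD _ _))// [leRHS]mulrDr; apply: lerD;
  rewrite cabsM ler_wpM2r ?cabs_ge0//.
  by rewrite (le_trans (h1 x xp))// lerDl ltW.
by rewrite (le_trans (h2 x xp))// lerDr ltW.
Qed.

Notation J0pi := (`[0, pi : R]%classic).
Notation mu := (@lebesgue_measure R).

(** A combination [g] with coefficient [1] on the [n]-th element pairs into the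
    derivative of a function that goes from [0] to [2 i pi], so [g] is not
    small. *)
Lemma phi_notin_closed_span :
  ~ closed_lin_span L2 L2norm (phi a) ([set m : int | m != 0] `\ n) (phi a n).
Proof.
have sys : system_in L2 (phi a) ([set m : int | m != 0] `\ n).
  by move=> m [m0 _]; exact: system_in_phi.
move=> /closP[Ln]; have [K K0 hK] := pair_bound.
have eK : 0 < pi / K ^+ 2 by rewrite divr_gt0 ?pi_gt0 ?exprn_gt0.
move=> /(_ _ eK)[s /[dup] ss /lin_spanP[l lD sE]].
pose g x := phi a n x - s x; rewrite -/g => gsmall.
have mg : mvec g.
  by apply: mvecB; apply: L2_mvec => //; exact: lin_span_L2 ss.
pose G0 x := \sum_(p <- l) p.2 * prim p.1 x.
have cG0 : ccont (fun x => pair x (s x)) /\ forall x, cder G0 (pair x (s x)) x.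
  rewrite sE /G0; elim: (l) => [|p l' [ih1 ih2]].
    split.
      rewrite (_ : (fun x => _) = (fun=> 0)); first exact: ccont_cst.
      by apply/funext => x; rewrite big_nil pair0.
    move=> x; rewrite big_nil pair0; under eq_fun do rewrite big_nil.
    exact: cder_cst.
  split.
    rewrite (_ : (fun x => _) = (fun x => p.2 * pair x (phi a p.1 x) +
      pair x ((\sum_(q <- l') q.2 *: phi a q.1) x))); last first.
      by apply/funext => x; rewrite big_cons pairD pairZ.
    apply: ccontD => //; apply: ccontM; first exact: ccont_cst.
    exact: ccont_pair_phi.
  move=> x; under eq_fun do rewrite big_cons.
  rewrite big_cons pairD pairZ; apply: cderD; last exact: ih2.
  exact/cderZ/cder_prim.
pose G x := prim n x - G0 x.
have cG x : cder G (pair x (g x)) x.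
  by rewrite pairB; apply: cderB; [exact: cder_prim|exact: cG0.2].
have cg : ccont (fun x => pair x (g x)).
  have -> : (fun x => pair x (g x)) =
      (fun x => pair x (phi a n x) + (- 1) * pair x (s x)).
    by apply/funext => x; rewrite pairB mulN1r.
  apply: ccontD; first exact: ccont_pair_phi.
  by apply: ccontM; [exact: ccont_cst|exact: cG0.1].
have G00 : G 0 = 0.
  by rewrite /G prim0 /G0 big1 ?subr0// => p _; rewrite prim0 mulr0.
have Gpi : G pi = 2 * 'i%C * pi%:C.
  rewrite /G prim_pi eqxx /G0 big_seq big1 ?subr0// => p /lD[_ /= /eqP pn].
  by rewrite prim_pi (negPf pn) mulr0.
have ftc : (\int[mu]_(x in J0pi) (Cim (pair x (g x)))%:E = (2 * pi)%:E)%E.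
  rewrite (@continuous_FTC2 _ _ (Cim \o G)) ?pi_gt0//.
  - rewrite /= G00 Gpi -EFinB; congr EFin; rewrite ImM/=; ring.
  - exact: continuous_subspaceT cg.2.
  - split.
    + by move=> x _; have h := (cG x).2; exact: ex_derive.
    + apply: cvg_at_right_filter; exact: (cder_ccont cG).2.
    + apply: cvg_at_left_filter; exact: (cder_ccont cG).2.
  - by move=> x _; rewrite derive1E; have [_ []] := cG x.
have mim : measurable_fun J0pi (fun x => Cim (pair x (g x))) by exact: (ccont_cmeas cg).2.
have : (\int[mu]_(x in J0pi) (Cim (pair x (g x)))%:E <=
    \int[mu]_(x in J0pi) ((K ^+ 2 / 2)%:E * (sqnormC2 (g x))%:E + 1%:E))%E.
  apply: (@le_trans _ _ `|\int[mu]_(x in J0pi) (Cim (pair x (g x)))%:E|%E).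
    exact: lee_abs.
  apply: (le_trans (le_abse_integral _ _ _)) => //; first exact/measurable_EFinP.
  apply: ge0_le_integral => //.
  - by apply/measurable_EFinP/measurableT_comp.
  - apply: emeasurable_funD => //; apply: measurable_funeM; exact: mvec_sqnormE.
  - move=> x; rewrite /= in_itv/= => xp; rewrite -EFinM -EFinD lee_fin.
    rewrite (le_trans (normr_Im_le _))// (le_trans (hK x _ xp))// sqnormC2E.
    set c1 := cabs _; set c2 := cabs _.
    have := sqr_ge0 (K * c1 - 1); have := sqr_ge0 (K * c2 - 1); lra.
rewrite ftc ge0_integralD//; last 2 first.
- by move=> x _; rewrite -EFinM lee_fin mulr_ge0 ?sqnormC2_ge0// divr_ge0// sqr_ge0.
- by apply: measurable_funeM; exact: mvec_sqnormE.
rewrite ge0_integralZl//; last 3 first.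
- exact: mvec_sqnormE.
- by move=> x _; rewrite lee_fin sqnormC2_ge0.
- by rewrite lee_fin divr_ge0// sqr_ge0.
rewrite integral_cst//= lebesgue_measure_0pi mul1e leNgt => /negP; apply.
rewrite -/(sqint g); move: gsmall (sqint_ge0 g); case: (sqint g) => // q.
rewrite lte_fin lee_fin => qK q0; rewrite -EFinM -EFinD lte_fin.
have K20 : 0 < K ^+ 2 by rewrite exprn_gt0.
move: qK; rewrite ltr_pdivlMr//; have := pi_gt0 R; lra.
Qed.

End biorthogonal.

Lemma minimal_phi : minimal_system L2 L2norm (phi a) [set n : int | n != 0].
Proof. by move=> n n0; exact: phi_notin_closed_span. Qed.

End root_functions.

(** * Components, steps and exponentials of half the argument *)

Section measurable_components.
Context {R : realType}.
Implicit Types p q : R -> R[i].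

Notation J0pi := (`[0, pi : R]%classic).
Notation mu := (@lebesgue_measure R).

Definition step (x0 x : R) : R[i] := if x0 <= x then 1 else 0.

Lemma sgn_atE x0 x : sgn_at x0 x = 2 * step x0 x - 1 :> R[i].
Proof. by rewrite /sgn_at /step; case: ifP => _; ring. Qed.

Lemma cmeas_cst (c : R[i]) : cmeas (fun=> c).
Proof. by split; exact: measurable_cst. Qed.

Lemma cmeasD p q : cmeas p -> cmeas q -> cmeas (fun x => p x + q x).
Proof.
move=> [p1 p2] [q1 q2]; split.
  rewrite (_ : (fun x => _) = (fun x => Cre (p x) + Cre (q x))).
    exact: measurable_funD.
  by apply/funext => x; rewrite ReD.
rewrite (_ : (fun x => _) = (fun x => Cim (p x) + Cim (q x))).
  exact: measurable_funD.
by apply/funext => x; rewrite ImD.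
Qed.

Lemma cmeasM p q : cmeas p -> cmeas q -> cmeas (fun x => p x * q x).
Proof.
move=> [p1 p2] [q1 q2]; split.
  rewrite (_ : (fun x => _) = (fun x => Cre (p x) * Cre (q x) - Cim (p x) * Cim (q x))).
    by apply: measurable_funB; exact: measurable_funM.
  by apply/funext => x; rewrite ReM.
rewrite (_ : (fun x => _) = (fun x => Cre (p x) * Cim (q x) + Cim (p x) * Cre (q x))).
  by apply: measurable_funD; exact: measurable_funM.
by apply/funext => x; rewrite ImM.
Qed.

Lemma cmeasB p q : cmeas p -> cmeas q -> cmeas (fun x => p x - q x).
Proof.
move=> hp hq; have := cmeasD hp (cmeasM (cmeas_cst (-1)) hq).
by congr cmeas; apply/funext => x; rewrite mulN1r.
Qed.

Lemma cmeas_step x0 : cmeas (step x0).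
Proof.
have mr : measurable (`[x0, +oo[%classic : set R) by exact: measurable_itv.
split.
  rewrite (_ : (fun x => _) = \1_(`[x0, +oo[%classic : set R)); first exact: measurable_indic.
  apply/funext => x; rewrite /step indicE mem_setE in_itv/= andbT.
  by case: ifP.
rewrite (_ : (fun x => _) = cst 0); first exact: measurable_cst.
by apply/funext => x; rewrite /step; case: ifP.
Qed.

Lemma cmeas_sgn_at x0 : cmeas (@sgn_at R x0).
Proof.
rewrite (_ : @sgn_at R x0 = fun x => 2 * step x0 x - 1); last first.
  by apply/funext => x; exact: sgn_atE.
by apply: cmeasB; [apply: cmeasM|]; [exact: cmeas_cst|exact: cmeas_step|exact: cmeas_cst].
Qed.

Lemma cabs_step_le x0 x : cabs (step x0 x : R[i]) <= 1.
Proof. by rewrite /step; case: ifP; rewrite ?cabs0 ?cabs1. Qed.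

Lemma cabs_sgn_at x0 x : cabs (sgn_at x0 x : R[i]) = 1.
Proof. by rewrite /sgn_at; case: ifP; rewrite ?cabsN cabs1. Qed.

Lemma L2_component (f : R -> 'cV[R[i]]_2) j : L2 f ->
  sq_integrable (fun x => Cre (f x j ord0)) /\ sq_integrable (fun x => Cim (f x j ord0)).
Proof.
move=> /L2E[[m1 m2] ff].
have le1 (v : 'cV[R[i]]_2) : cabs (v j ord0) ^+ 2 <= sqnormC2 v.
  rewrite sqnormC2E; have [k ->|->] := unliftP ord0 j.
    by rewrite (ord1 k) lerDr sqr_ge0.
  by rewrite lerDl sqr_ge0.
split; split=> //; apply: (le_lt_trans _ ff); apply: ge0_le_integral => //.
- by move=> x _; rewrite lee_fin sqr_ge0.
- by apply/measurable_EFinP; apply: measurable_funX; exact: m1.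
- exact: mvec_sqnormE (conj m1 m2).
- move=> x _; rewrite lee_fin (le_trans _ (le1 _))// sqr_cabs lerDl sqr_ge0//.
- by move=> x _; rewrite lee_fin sqr_ge0.
- by apply/measurable_EFinP; apply: measurable_funX; exact: m2.
- exact: mvec_sqnormE (conj m1 m2).
- move=> x _; rewrite lee_fin (le_trans _ (le1 _))// sqr_cabs lerDr sqr_ge0//.
Qed.

End measurable_components.

Section half_exponentials.
Context {R : realType}.
Implicit Types z : R[i].

Lemma half_expD z (x x' : R) : half_exp z (x + x') = half_exp z x * half_exp z x'.
Proof. by rewrite /half_exp -expCD rmorphD mulrDr. Qed.

Lemma cder_half_exp z x : cder (half_exp z) (z / 2 * half_exp z x) x.
Proof. exact: cder_expC. Qed.

Lemma half_expV z x : (half_exp z x)^-1 = half_exp (- z) x.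
Proof. by rewrite /half_exp -expCN; congr expC; ring. Qed.

Lemma ccont_half_exp z : ccont (half_exp z). Proof. exact: ccont_expC. Qed.

Lemma half_exp_bounds z : exists2 B, 1 <= B &
  forall x : R, 0 <= x <= pi -> cabs (half_exp z x) <= B /\ cabs (half_exp z x)^-1 <= B.
Proof.
have [B1 B10 h1] := ccont_bounded 0 pi (ccont_half_exp z).
have [B2 B20 h2] := ccont_bounded 0 pi (ccont_half_exp (- z)).
exists (1 + (B1 + B2)) => [|x xp]; first by rewrite lerDl ltW// addr_gt0.
rewrite half_expV; have := h1 x xp; have := h2 x xp; split; lra.
Qed.

(** The derivative of [expC (z t)] at [0] is [z], and its variation near [0] is
    small. *)
Lemma expC_lower z : z != 0 -> exists2 r, 0 < r &
  forall t : R, 0 < t < r -> cabs z * t / 2 <= cabs (expC (z * t%:C) - 1).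
Proof.
move=> z0; have cz : 0 < cabs z by rewrite cabs_gt0.
have e0 : 0 < 4^-1 :> R by rewrite invr_gt0.
have [r r0 hr] := ccont_eps 0 (ccont_expC z) e0.
exists r => // t /andP[t0 tr].
have der x : cder (fun x => expC (z * x%:C) - z * x%:C) (z * expC (z * x%:C) - z) x.
  have := cderB (cder_expC z x) (cderZ z (cder_id x)); by rewrite mulr1.
have : cabs (expC (z * t%:C) - z * t%:C - (expC (z * 0%:C) - z * 0%:C)) <=
    2 * (cabs z / 4) * (t - 0).
  apply: (cabs_increment_le (ltW t0) der) => x /andP[x0 xt].
  rewrite -[X in _ - X]mulr1 -mulrBr cabsM ler_pM2l//.
  have := hr x; rewrite subr0 gtr0_norm// (lt_trans xt tr) => /(_ isT).
  by rewrite mulr0 expC0 => /ltW.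
rewrite mulr0 expC0 !subr0.
set E := expC _; have -> : E - z * t%:C - 1 = (E - 1) - z * t%:C by ring.
move=> h; have : cabs (z * t%:C) <= cabs (E - 1) + cabs (E - 1 - z * t%:C).
  by rewrite -[X in cabs X <= _](subKr (E - 1)) cabsB.
rewrite cabsM cabs_real gtr0_norm//; lra.
Qed.

End half_exponentials.

(** * From functions on the curve to elements of the closed span *)

Section transfer.
Context {R : realType}.
Variables (a : R[i]) (y : R).
Hypothesis ay : `|Cim a - y * Cre a| < 1.

Notation clos := (closed_lin_span L2 L2norm (phi a) [set n : int | n != 0]).
Notation u := (branch a true).
Notation w := (branch a false).

Let sys : system_in L2 (phi a) [set n : int | n != 0].
Proof. exact: system_in_phi. Qed.

Let i_neq0 : 'i%C != 0 :> R[i]. Proof. by rewrite -cabs_gt0 cabs_i. Qed.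

Let piC_neq0 : (pi%:C : R[i]) != 0.
Proof. by rewrite -cabs_gt0 cabs_real normr_gt0 lt0r_neq0// pi_gt0. Qed.

(** [Theta D b] is the element that corresponds to a function [q] on the closed
    curve with [b x = q (w x)] and [D] the primitive vanishing at [0] of
    [u q (u x) - w q (w x)]: the mean of [q] is removed, the first component
    then integrates [q] along the curve from [w x] to [u x], and the monomial
    of exponent [n != 0] gives [phi a n] up to the factor [n]. *)
Definition Theta (D b : R -> R[i]) : R -> 'cV[R[i]]_2 :=
  vec2 (fun x => (D x - x%:C / pi%:C * D pi) / (2 * 'i%C))
       (fun x => 'i%C * (b x - D pi / (2 * 'i%C * pi%:C))).

Definition laurent_prim (l : seq (int * R[i])) (x : R) : R[i] :=
  \sum_(p <- l) p.2 *
    (if p.1 == 0 then 2 * 'i%C * x%:C else (monom a true p.1 x - monom a false p.1 x) / p.1%:~R).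

Lemma ThetaD D b D' b' : Theta (fun x => D x + D' x) (fun x => b x + b' x) =
  (fun x => Theta D b x + Theta D' b' x).
Proof.
by apply/funext => x; apply: vec2P; rewrite !mxE/=; move: piC_neq0;
  move: (pi%:C) (x%:C) => p X p0; field; rewrite i_neq0 p0.
Qed.

Lemma ThetaZ c D b : Theta (fun x => c * D x) (fun x => c * b x) = (fun x => c *: Theta D b x).
Proof.
by apply/funext => x; apply: vec2P; rewrite !mxE/=; move: piC_neq0;
  move: (pi%:C) (x%:C) => p X p0; field; rewrite i_neq0 p0.
Qed.

Lemma clos_ThetaD D b D' b' : clos (Theta D b) -> clos (Theta D' b') ->
  clos (Theta (fun x => D x + D' x) (fun x => b x + b' x)).
Proof. by move=> h h'; rewrite ThetaD; exact: (closD sys h h'). Qed.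

Lemma clos_ThetaZ c D b : clos (Theta D b) ->
  clos (Theta (fun x => c * D x) (fun x => c * b x)).
Proof. by move=> h; rewrite ThetaZ; exact: (closZ sys c h). Qed.

Lemma clos_Theta_laurent l :
  clos (Theta (laurent_prim l) (fun x => laurent l (w * x%:C))).
Proof.
elim: l => [|[n c] l ih].
  rewrite (_ : Theta _ _ = 0); first exact: (clos_span sys (lin_span0 _ _)).
  apply/funext => x; apply: vec2P; rewrite !mxE/= /laurent_prim /laurent !big_nil.
    by rewrite mulr0 subr0 mul0r.
  by rewrite mul0r subr0 mulr0.
pose dn x : R[i] := if n == 0 then 2 * 'i%C * x%:C
  else (monom a true n x - monom a false n x) / n%:~R.
have cn : clos (Theta dn (monom a false n)).
  rewrite /dn; have [n0|n0] := eqVneq n 0.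
    rewrite (_ : Theta _ _ = 0); first exact: (clos_span sys (lin_span0 _ _)).
    apply/funext => x; apply: vec2P; rewrite !mxE/=; move: piC_neq0;
      rewrite /monom ?n0 ?mul0r ?expC0; move: (pi%:C) (x%:C) => p X p0; field;
      by rewrite ?i_neq0 ?p0.
  rewrite (_ : Theta _ _ = (fun x => n%:~R^-1 *: phi a n x)).
    have ln : lin_span (phi a) [set n : int | n != 0] (phi a n).
      exact: lin_span_gen.
    exact: (closZ sys _ (clos_span sys ln)).
  have nC : (n%:~R : R[i]) != 0 by rewrite intr_eq0.
  apply/funext => x; rewrite phiE; apply: vec2P; rewrite !mxE/= monom_pi subrr mul0r.
    by rewrite mulr0 subr0; field; rewrite i_neq0 nC.
  by rewrite mul0r subr0; field; exact: nC.
rewrite (_ : laurent_prim _ = fun x => c * dn x + laurent_prim l x); last first.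
  by apply/funext => x; rewrite /laurent_prim big_cons.
rewrite (_ : (fun x => laurent _ _) =
    fun x => c * monom a false n x + laurent l (w * x%:C)); last first.
  by apply/funext => x; rewrite /laurent big_cons.
exact: (clos_ThetaD (clos_ThetaZ c cn) ih).
Qed.

Lemma laurent_prim0 l : laurent_prim l 0 = 0.
Proof.
rewrite /laurent_prim big1// => p _; case: ifP => _.
  by rewrite !mulr0.
by rewrite !monom0 subrr mul0r mulr0.
Qed.

Let uw : u - w = 2 * 'i%C.
Proof. by rewrite /branch; move: ('i%C : R[i]) => i /=; ring. Qed.

Lemma cder_laurent_prim l x : cder (laurent_prim l)
  (u * laurent l (u * x%:C) - w * laurent l (w * x%:C)) x.
Proof.
elim: l => [|[n c] l ih].
  rewrite (_ : laurent_prim [::] = fun=> 0); last first.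
    by apply/funext => t; rewrite /laurent_prim big_nil.
  by rewrite /laurent !big_nil !mulr0 subrr; exact: cder_cst.
rewrite (_ : laurent_prim _ = fun x =>
  c * (if n == 0 then 2 * 'i%C * x%:C
       else (monom a true n x - monom a false n x) / n%:~R) + laurent_prim l x); last first.
  by apply/funext => t; rewrite /laurent_prim big_cons.
rewrite (_ : _ - _ = c * (u * monom a true n x - w * monom a false n x) +
    (u * laurent l (u * x%:C) - w * laurent l (w * x%:C))); last first.
  by rewrite /laurent !big_cons/= -/(monom a true n x) -/(monom a false n x); ring.
apply: cderD => //; apply: cderZ.
have [n0|n0] := eqVneq n 0.
  rewrite /monom n0 !mul0r expC0 !mulr1 uw.
  by have := cderZ (2 * 'i%C) (cder_id x); rewrite mulr1.
have nC : (n%:~R : R[i]) != 0 by rewrite intr_eq0.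
have := cderZ (n%:~R^-1) (cderB (cder_monom a true n x) (cder_monom a false n x)).
rewrite (_ : (fun x => _^-1 * _) = (fun x => (monom a true n x - monom a false n x) / n%:~R)).
  by congr cder; field; exact: nC.
by apply/funext => t; rewrite mulrC.
Qed.

Let ThetaB D b D' b' x :
  Theta D b x - Theta D' b' x = Theta (fun x => D x - D' x) (fun x => b x - b' x) x.
Proof.
by apply: vec2P; rewrite !mxE/=; move: piC_neq0;
  move: (pi%:C) (x%:C) => p X p0; field; rewrite i_neq0 p0.
Qed.

Lemma cabs_2i : cabs (2 * 'i%C : R[i]) = 2.
Proof. by rewrite cabsM cabs_nat cabs_i mulr1. Qed.

Let Theta_bound D b e x : 0 <= x <= pi ->
  (forall x, 0 <= x <= pi -> cabs (D x) <= e /\ cabs (b x) <= e) ->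
  cabs (Theta D b x ord0 ord0) <= 2 * e /\ cabs (Theta D b x (lift ord0 ord0) ord0) <= 2 * e.
Proof.
move=> xp h; rewrite !mxE/=; have [h1 h2] := h x xp.
have pi0 := pi_gt0 R; have pi2 := pi_ge2 R.
have [h3 _] : cabs (D pi) <= e /\ cabs (b pi) <= e by apply: h; rewrite lexx ltW.
have e0 : 0 <= e by rewrite (le_trans (cabs_ge0 _) h1).
have xpi : x / pi <= 1 by rewrite ler_pdivrMr// mul1r; case/andP: xp.
have x0 : 0 <= x / pi by rewrite divr_ge0 ?(ltW pi0)//; case/andP: xp.
split.
  rewrite cabsM cabsV cabs_2i ler_pdivrMr//.
  have : cabs (x%:C / pi%:C * D pi) <= 1 * e.
    rewrite cabsM -[_ / pi%:C](fmorph_div (real_complex R)) cabs_real ger0_norm//.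
    by rewrite ler_pM ?cabs_ge0.
  have := cabsB (D x) (x%:C / pi%:C * D pi); lra.
rewrite cabsM cabs_i mul1r.
have : cabs (D pi / (2 * 'i%C * pi%:C)) <= e.
  rewrite cabsM cabsV cabsM cabs_2i cabs_real gtr0_norm// ler_pdivrMr ?mulr_gt0//.
  rewrite (le_trans h3)// ler_peMr//; lra.
have := cabsB (b x) (D pi / (2 * 'i%C * pi%:C)); lra.
Qed.

Let Theta_sqnorm D b e x : 0 <= x <= pi ->
  (forall x, 0 <= x <= pi -> cabs (D x) <= e /\ cabs (b x) <= e) ->
  sqnormC2 (Theta D b x) <= 8 * e ^+ 2.
Proof.
move=> xp h; have [h1 h2] := Theta_bound xp h.
have e2 : 0 <= 2 * e by rewrite (le_trans (cabs_ge0 _) h1).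
rewrite sqnormC2E (_ : 8 * e ^+ 2 = (2 * e) ^+ 2 + (2 * e) ^+ 2); last by ring.
by rewrite lerD// ler_pXn2r ?nnegrE ?cabs_ge0.
Qed.

Lemma L2_Theta D b (M : R) : cmeas D -> cmeas b ->
  (forall x, 0 <= x <= pi -> cabs (D x) <= M /\ cabs (b x) <= M) -> L2 (Theta D b).
Proof.
move=> mD mb h; apply: (@mvec_bounded_L2 _ _ (8 * M ^+ 2)); last first.
  by move=> x xp; exact: Theta_sqnorm.
have cx (c : R[i]) : cmeas (fun x => x%:C / pi%:C * c).
  apply: ccont_cmeas; apply: ccontM; last exact: ccont_cst.
  by apply: ccontM; [apply: cder_ccont => x; exact: cder_id|exact: ccont_cst].
apply: mvec_vec2.
  by apply: cmeasM; [exact: cmeasB|exact: cmeas_cst].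
apply: cmeasM; first exact: cmeas_cst.
by apply: cmeasB => //; exact: cmeas_cst.
Qed.

Lemma clos_Theta_unif D b (M : R) : cmeas D -> cmeas b ->
  (forall x, 0 <= x <= pi -> cabs (D x) <= M /\ cabs (b x) <= M) ->
  (forall e, 0 < e -> exists D' b', clos (Theta D' b') /\
     forall x, 0 <= x <= pi -> cabs (D x - D' x) <= e /\ cabs (b x - b' x) <= e) ->
  clos (Theta D b).
Proof.
move=> mD mb hM h; apply: (clos_lim_unif sys (L2_Theta mD mb hM)) => e e0.
pose r := Num.min 1 (e / 8).
have r0 : 0 < r by rewrite lt_min ltr01 divr_gt0.
have r1 : r <= 1 by rewrite ge_min lexx.
have re : r <= e / 8 by rewrite ge_min lexx orbT.
have [D' [b' [c' h']]] := h r r0; exists (Theta D' b') => // x xp.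
rewrite ThetaB (le_trans (Theta_sqnorm xp h'))// expr2.
have : r * r <= r * 1 by rewrite ler_wpM2l// ltW.
lra.
Qed.

(** For [s = sgn_at x0 x] this is, up to sign, the primitive vanishing at [0] of
    [u q (u x) - w q (w x)], where [q] is the uniform limit of Laurent
    polynomials given by [laurent_sign].  It is continuous because the factor of
    [s] is [(v - z) ^+ 2 / v], which vanishes at [x0]. *)
Definition jump_prim (b : bool) (s : R[i]) (x0 x : R) : R[i] :=
  let z := half_exp (branch a b) x0 in
  let v := half_exp (branch a b) x in
  let v' := half_exp (branch a (~~ b)) x in
  2 * s * (v + z ^+ 2 / v - 2 * z) + 2 * (v' + z ^+ 2 / v' - 2 * z).

Lemma cder_jump_prim b s x0 x : cder (jump_prim b s x0)
  (s * (branch a b * half_sinh (branch a b) x0 (branch a b) x) +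
   branch a (~~ b) * half_sinh (branch a b) x0 (branch a (~~ b)) x) x.
Proof.
rewrite /jump_prim /half_sinh; set z := half_exp (branch a b) x0.
have H c (v : R[i]) : cder (fun x => 2 * c * (half_exp v x + z ^+ 2 / half_exp v x - 2 * z))
    (c * (v * (half_exp v x - z ^+ 2 / half_exp v x))) x.
  rewrite (_ : (fun x => _) = fun x => 2 * c * (half_exp v x + z ^+ 2 * half_exp (- v) x - 2 * z)).
    have := cderZ (2 * c) (cderB (cderD (cder_half_exp v x)
      (cderZ (z ^+ 2) (cder_half_exp (- v) x))) (cder_cst (2 * z) x)).
    by congr cder; rewrite -half_expV; field; exact: half_exp_neq0.
  by apply/funext => t; rewrite half_expV.
have := cderD (H s (branch a b)) (H 1 (branch a (~~ b))).
by rewrite mul1r; congr cder; apply/funext => t; rewrite mulr1.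
Qed.

Definition branch_sign (b : bool) : R[i] := if b then 1 else -1.

(** Both sides vanish at [0] and have uniformly close derivatives on each side
    of [x0]. *)
Lemma laurent_prim_approx b x0 l e : 0 < x0 < pi -> 0 <= e ->
  (forall x, 0 <= x <= pi ->
    cabs (laurent l (branch a b * x%:C) -
          sgn_at x0 x * half_sinh (branch a b) x0 (branch a b) x) <= e /\
    cabs (laurent l (branch a (~~ b) * x%:C) +
          half_sinh (branch a b) x0 (branch a (~~ b)) x) <= e) ->
  forall x, 0 <= x <= pi ->
  cabs (branch_sign b * jump_prim b (sgn_at x0 x) x0 x - laurent_prim l x) <=
    2 * ((cabs u + cabs w) * e) * pi.
Proof.
move=> /andP[x00 x0p] e0 h.
pose M := (cabs u + cabs w) * e.
have M0 : 0 <= M by rewrite mulr_ge0// addr_ge0// cabs_ge0.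
pose f s x := branch_sign b * jump_prim b s x0 x - laurent_prim l x.
pose df s x := branch_sign b * (s * (branch a b * half_sinh (branch a b) x0 (branch a b) x) +
     branch a (~~ b) * half_sinh (branch a b) x0 (branch a (~~ b)) x) -
  (u * laurent l (u * x%:C) - w * laurent l (w * x%:C)).
have cf s x : cder (f s) (df s x) x.
  by apply: cderB; [exact: cderZ (cder_jump_prim b s x0 x)|exact: cder_laurent_prim].
have bdf x : 0 <= x <= pi -> cabs (df (sgn_at x0 x) x) <= M.
  move=> /h; rewrite /df /M /branch_sign.
  set s := sgn_at x0 x; case: (b) => /= -[]; set k1 := half_sinh _ _ _ _;
    set k2 := half_sinh _ _ _ _; set q1 := laurent l _; set q2 := laurent l _ => h1 h2.
    rewrite (_ : _ - _ = u * - (q1 - s * k1) + w * (q2 + k2)); last by ring.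
    rewrite (le_trans (cabsD _ _))// [leRHS]mulrDl !cabsM cabsN.
    by rewrite lerD// ler_wpM2l ?cabs_ge0.
  rewrite (_ : _ - _ = w * (q1 - s * k1) + u * - (q2 + k2)); last by ring.
  rewrite (le_trans (cabsD _ _))// [leRHS]mulrDl [leLHS]addrC !cabsM cabsN.
  by rewrite lerD// ler_wpM2l ?cabs_ge0.
have f0 : f (-1) 0 = 0.
  by rewrite /f laurent_prim0 subr0 /jump_prim !half_exp0; field.
have fx0 : f 1 x0 = f (-1) x0.
  by rewrite /f; congr (_ * _ - _); rewrite /jump_prim; field; rewrite !half_exp_neq0.
have left x : 0 <= x <= x0 -> cabs (f (-1) x) <= 2 * M * x.
  move=> /andP[xge0 xle].
  have := cabs_increment_le (M := M) xge0 (cf (-1)); rewrite f0 !subr0; apply => t /andP[t0 tx].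
  have -> : -1 = sgn_at x0 t :> R[i] by rewrite /sgn_at (leNgt x0) (lt_le_trans tx xle).
  apply: bdf; rewrite ltW//= (le_trans (ltW tx))// (le_trans xle)//; exact: ltW.
move=> x /andP[xge0 xle]; rewrite -/(f _ x) -/M.
have [xx0|x0x] := ltP x x0.
  rewrite /sgn_at (leNgt x0) xx0/= (le_trans (left x _)) ?xge0 ?(ltW xx0)//.
  by rewrite ler_wpM2l// mulr_ge0.
rewrite /sgn_at x0x.
have h1 : cabs (f 1 x - f 1 x0) <= 2 * M * (x - x0).
  apply: (cabs_increment_le x0x (cf 1)) => t /andP[t0 tx].
  have -> : 1 = sgn_at x0 t :> R[i] by rewrite /sgn_at (ltW t0).
  by apply: bdf; rewrite !ltW// ?(lt_le_trans tx)// (lt_trans x00).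
have h2 := left x0; rewrite lexx ltW// in h2; have {}h2 := h2 isT.
rewrite -[f 1 x](subrK (f 1 x0)) (le_trans (cabsD _ _))// {2}fx0.
have : M * x <= M * pi by rewrite ler_wpM2l.
lra.
Qed.

End transfer.

(** * The first component *)

Section jumps.
Context {R : realType}.
Variables (a : R[i]) (y : R).
Hypothesis ay : `|Cim a - y * Cre a| < 1.

Notation clos := (closed_lin_span L2 L2norm (phi a) [set n : int | n != 0]).
Notation u := (branch a true).
Notation w := (branch a false).

Let sys : system_in L2 (phi a) [set n : int | n != 0].
Proof. exact: system_in_phi. Qed.

Let i_neq0 : 'i%C != 0 :> R[i]. Proof. by rewrite -cabs_gt0 cabs_i. Qed.

Lemma branch_neq0 b : branch a b != 0.
Proof.
apply/eqP => h; have := congr1 Cre h; have := congr1 Cim h; move: ay.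
rewrite /branch ImD ReD; case: (b) => /=; rewrite ?oppr0 addr0 => h1 h0 h2;
  move: h1; rewrite h2 mulr0 subr0.
  by have -> : Cim a = -1; [lra|rewrite normrN1 ltxx].
by have -> : Cim a = 1; [lra|rewrite normr1 ltxx].
Qed.

Definition jump_snd (b : bool) (x0 x : R) : R[i] :=
  if b then - half_sinh (branch a b) x0 w x
  else sgn_at x0 x * half_sinh (branch a b) x0 w x.

Lemma clos_Theta_jump b x0 : 0 < x0 < pi ->
  clos (Theta (fun x => branch_sign b * jump_prim a b (sgn_at x0 x) x0 x) (jump_snd b x0)).
Proof.
move=> x0p.
have cj s : ccont (jump_prim a b s x0) by exact: cder_ccont (cder_jump_prim a b s x0).
have jE s x : jump_prim a b s x0 x =
    s * (jump_prim a b 1 x0 x + -1 * jump_prim a b 0 x0 x) + jump_prim a b 0 x0 x.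
  by rewrite /jump_prim; ring.
have c1 : ccont (fun x => jump_prim a b 1 x0 x + -1 * jump_prim a b 0 x0 x).
  by apply: ccontD => //; apply: ccontM => //; exact: ccont_cst.
have chs : ccont (half_sinh (branch a b) x0 w) by exact: ccont_half_sinh.
have [M1 M10 h1] := ccont_bounded 0 pi c1.
have [M2 M20 h2] := ccont_bounded 0 pi (cj 0).
have [M3 M30 h3] := ccont_bounded 0 pi chs.
have ms := @cmeas_sgn_at R x0.
have bs1 : cabs (branch_sign b : R[i]) = 1.
  by rewrite /branch_sign; case: (b); rewrite ?cabsN cabs1.
apply: (@clos_Theta_unif _ _ _ _ (M1 + M2 + M3)).
- apply: cmeasM; first exact: cmeas_cst.
  rewrite (_ : (fun x => _) = fun x => sgn_at x0 x *
    (jump_prim a b 1 x0 x + -1 * jump_prim a b 0 x0 x) + jump_prim a b 0 x0 x).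
    by apply: cmeasD; [apply: cmeasM => //|]; exact: ccont_cmeas.
  by apply/funext => x; exact: jE.
- rewrite /jump_snd; case: (b) chs => chs.
    rewrite (_ : (fun x => _) = fun x => -1 * half_sinh u x0 w x).
      by apply: cmeasM; [exact: cmeas_cst|exact: ccont_cmeas].
    by apply/funext => x; rewrite mulN1r.
  by apply: cmeasM => //; exact: ccont_cmeas.
- move=> x xp; have k1 := h1 x xp; have k2 := h2 x xp; have k3 := h3 x xp; split.
    rewrite cabsM bs1 mul1r jE (le_trans (cabsD _ _))// cabsM cabs_sgn_at mul1r; lra.
  suff -> : cabs (jump_snd b x0 x) = cabs (half_sinh (branch a b) x0 w x) by lra.
  by rewrite /jump_snd; case: (b); rewrite ?cabsN// cabsM cabs_sgn_at mul1r.
move=> e e0; pose K := 1 + 2 * (cabs u + cabs w) * pi.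
have uw0 : 0 <= 2 * (cabs u + cabs w) * pi.
  by rewrite mulr_ge0 ?pi_ge0// mulr_ge0// addr_ge0 ?cabs_ge0.
have K0 : 0 < K by rewrite ltr_wpDr.
have r0 : 0 < e / K by rewrite divr_gt0.
have re : e / K <= e by rewrite ler_pdivrMr// ler_peMr ?(ltW e0)// lerDl.
have [l hl] := laurent_sign ay b x0p r0.
exists (laurent_prim a l), (fun x => laurent l (w * x%:C)); split.
  exact: clos_Theta_laurent.
move=> x xp; split.
  apply: (le_trans (laurent_prim_approx x0p (ltW r0) hl xp)).
  rewrite (_ : 2 * _ * pi = e / K * (2 * (cabs u + cabs w) * pi)); last by ring.
  rewrite -mulrA; apply: ler_piMr; first exact: ltW.
  by rewrite mulrC ler_pdivrMr// mul1r /K; lra.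
apply: (le_trans _ re); have [] := hl x xp.
rewrite /jump_snd; case: (b) => /= q1 q2.
  by rewrite -opprD cabsN addrC.
by rewrite cabs_distC.
Qed.

(** As a function of [t = half_exp u x0], [jump_prim] is a combination of [1],
    [t ^+ 2] and, after the jump, [t].  A combination over three nearby nodes
    whose coefficients annihilate [1] and [t ^+ 2] therefore vanishes to the left
    of the nodes and is a constant, [kap], to their right; the second component
    vanishes altogether.  Divided by [kap], it tends to a step as the nodes
    merge. *)
Lemma clos_Theta_step x1 : 0 < x1 < pi -> clos (Theta (step x1) (fun=> 0)).
Proof.
move=> /andP[x10 x1p]; have pi0 := pi_gt0 R.
have [B B1 hB] := half_exp_bounds u.
have B0 : 0 < B by exact: lt_le_trans B1.
have u2 : u / 2 != 0 by rewrite mulf_neq0 ?branch_neq0// invr_neq0// pnatr_eq0.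
have [r r0 hr] := expC_lower u2.
pose cu := cabs (u / 2).
have cu0 : 0 < cu by rewrite cabs_gt0.
pose L := 2 * (cu * B).
have L0 : 0 <= L by rewrite !mulr_ge0// ltW.
have lip x x' : 0 <= x -> x <= x' -> x' <= pi ->
    cabs (half_exp u x' - half_exp u x) <= L * (x' - x).
  move=> h1 h2 h3; apply: (cabs_increment_le h2 (cder_half_exp u)) => t /andP[t1 t2].
  rewrite cabsM ler_wpM2l ?cabs_ge0//; apply: (hB t _).1; apply/andP; split; lra.
(* Between the nodes, the numerator of [T - 1 / 2] is [O (dl ^+ 2)] by the
   Lipschitz bound [lip], and [kap] is at least a constant times [dl ^+ 2]. *)
pose C0 := 3 * (1 + B ^+ 2) * (2 * (2 * L) ^+ 2 * B) / (8 * (B^-1 * B^-1) * (cu / 2) ^+ 2).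
pose C := 2 + C0.
have C00 : 0 <= C0.
  have B0' := ltW B0; rewrite /C0; apply: divr_ge0; apply: mulr_ge0.
  - by rewrite mulr_ge0// addr_ge0// sqr_ge0.
  - by apply: mulr_ge0 => //; rewrite mulr_ge0// sqr_ge0.
  - by rewrite mulr_ge0// mulr_ge0 ?invr_ge0.
  - exact: sqr_ge0.
have mstep := @cmeas_step R x1.
have LT : L2 (Theta (step x1) (fun=> 0)).
  apply: (@L2_Theta _ _ _ 1) => //.
  by move=> x _; rewrite cabs0 cabs_step_le.
apply: (clos_lim_local sys (C := C ^+ 2) LT).
move=> e e0.
(* [dl] is the distance between consecutive nodes. *)
pose dl := Num.min (e / 2) (Num.min (r / 2) ((pi - x1) / 4)).
have dl0 : 0 < dl by rewrite !lt_min !divr_gt0// subr_gt0.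
have dle : dl <= e / 2 by rewrite ge_min lexx.
have dlr : dl <= r / 2 by rewrite !ge_min lexx orbT.
have dlp : dl <= (pi - x1) / 4 by rewrite !ge_min lexx !orbT.
pose x2 := x1 + dl; pose x3 := x1 + dl + dl.
pose rho := half_exp u dl; pose t := half_exp u x1.
have t2E : half_exp u x2 = t * rho by rewrite half_expD.
have t3E : half_exp u x3 = t * rho * rho by rewrite !half_expD.
have t0 : t != 0 by exact: half_exp_neq0.
have rho0 : rho != 0 by exact: half_exp_neq0.
have rho1 : cu * dl / 2 <= cabs (rho - 1).
  by apply: hr; apply/andP; split; lra.
have rho1n : rho - 1 != 0.
  by rewrite -cabs_gt0 (lt_le_trans _ rho1)// divr_gt0// mulr_gt0.
pose kap : R[i] := 8 * t * rho * (rho - 1) ^+ 2.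
have kap0 : kap != 0.
  apply: mulf_neq0; last exact: expf_neq0.
  by apply: mulf_neq0 => //; apply: mulf_neq0 => //; rewrite pnatr_eq0.
have x1in : 0 < x1 < pi by rewrite x10.
have x2in : 0 < x2 < pi by apply/andP; split; rewrite /x2; lra.
have x3in : 0 < x3 < pi by apply/andP; split; rewrite /x3; lra.
pose jp x0 x := branch_sign true * jump_prim a true (sgn_at x0 x) x0 x.
pose T x := kap^-1 * (rho ^+ 2 * jp x1 x + (- (1 + rho ^+ 2) * jp x2 x + jp x3 x)).
have cT : clos (Theta T (fun=> 0)).
  have := clos_ThetaZ kap^-1 (clos_ThetaD
    (clos_ThetaZ (rho ^+ 2) (clos_Theta_jump true x1in)) (clos_ThetaD
    (clos_ThetaZ (- (1 + rho ^+ 2)) (clos_Theta_jump true x2in))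
    (clos_Theta_jump true x3in))).
  congr (clos (Theta _ _)); apply/funext => x.
  rewrite /jump_snd /half_sinh t2E t3E -/t.
  by move: (half_exp_neq0 w x) => w0; field; rewrite w0 kap0.
pose g := Theta T (fun=> 0).
exists g; exists x1; split=> // x xp; rewrite /g; have [xge0 xle] := andP xp.
have TE x' s1 s2 s3 : sgn_at x1 x' = s1 -> sgn_at x2 x' = s2 -> sgn_at x3 x' = s3 ->
    T x' = 2^-1 + kap^-1 * (2 * s1 * rho ^+ 2 * ((half_exp u x' - t) ^+ 2 / half_exp u x')
      - 2 * s2 * (1 + rho ^+ 2) * ((half_exp u x' - t * rho) ^+ 2 / half_exp u x')
      + 2 * s3 * ((half_exp u x' - t * rho * rho) ^+ 2 / half_exp u x')).
  move=> e1 e2 e3; rewrite /T /jp e1 e2 e3 /jump_prim /branch_sign t2E t3E -/t /kap.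
  move: (half_exp_neq0 u x') (half_exp_neq0 w x') t0 rho0 rho1n => /=.
  move: (half_exp u x') (half_exp w x') (t) (rho) => U W t' r' U0 W0 t0' r0' r1'.
  by field; rewrite U0 W0 t0' r0' r1'.
have sgn_l x0 x' : x' < x0 -> sgn_at x0 x' = -1 :> R[i].
  by move=> h; rewrite /sgn_at (leNgt x0) h.
have sgn_r x0 x' : x0 <= x' -> sgn_at x0 x' = 1 :> R[i].
  by move=> h; rewrite /sgn_at h.
have T_left x' : x' < x1 -> T x' = 0.
  move=> h; rewrite (@TE x' (-1) (-1) (-1)); last 3 first.
  - by apply: sgn_l.
  - by apply: sgn_l; rewrite /x2; lra.
  - by apply: sgn_l; rewrite /x3; lra.
  rewrite /kap; move: (half_exp_neq0 u x') t0 rho0 rho1n => /=.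
  move: (half_exp u x') (t) (rho) => U t' r' U0 t0' r0' r1'.
  by field; rewrite U0 t0' r0' r1'.
have T_right x' : x3 <= x' -> T x' = 1.
  move=> h; rewrite (@TE x' 1 1 1); last 3 first.
  - by apply: sgn_r; move: h; rewrite /x3; lra.
  - by apply: sgn_r; move: h; rewrite /x3 /x2; lra.
  - exact: sgn_r.
  rewrite /kap; move: (half_exp_neq0 u x') t0 rho0 rho1n => /=.
  move: (half_exp u x') (t) (rho) => U t' r' U0 t0' r0' r1'.
  by field; rewrite U0 t0' r0' r1'.
have Tpi : T pi = 1 by apply: T_right; move/andP: x3in => [_ /ltW].
have sp : step x1 pi = 1 :> R[i] by rewrite /step (ltW x1p).
have diff : sqnormC2 (Theta (step x1) (fun=> 0) x - Theta T (fun=> 0) x) =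
    cabs (step x1 x - T x) ^+ 2 / 4.
  rewrite sqnormC2E !mxE/= sp Tpi subrr cabs0 expr0n addr0 /=.
  rewrite -mulrBl cabsM cabsV cabs_2i exprMn opprD addrACA subrr addr0.
  by congr (_ * _); rewrite exprVn; congr (_^-1); ring.
rewrite diff; have [xl|x1x] := ltP x x1.
  by rewrite /step (leNgt x1) xl/= T_left// subrr cabs0 expr0n/= mul0r.
have [x3x|xx3] := leP x3 x.
  rewrite T_right// /step x1x subrr cabs0 expr0n/= mul0r.
  by case: ifP => // _; exact: sqr_ge0.
have -> /= : x <= x1 + e by move: xx3; rewrite /x3; lra.
have B10 : 0 < B^-1 by rewrite invr_gt0.
have inv_le (z : R[i]) : z != 0 -> cabs z^-1 <= B -> B^-1 <= cabs z.
  by move=> z0 h; rewrite -[cabs z]invrK lef_pV2 ?posrE// -cabsV// cabs_gt0 invr_neq0.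
suff hT : cabs (T x) <= 1 + C0.
  have : cabs (step x1 x - T x) <= C.
    by have := cabsB (step x1 x) (T x); have := @cabs_step_le R x1 x; rewrite /C; lra.
  move=> h; have : cabs (step x1 x - T x) ^+ 2 <= C ^+ 2.
    by rewrite ler_pXn2r ?nnegrE ?cabs_ge0// (le_trans (cabs_ge0 _) h).
  by have := sqr_ge0 (cabs (step x1 x - T x)); lra.
rewrite (TE _ _ _ _ erefl erefl erefl) (le_trans (cabsD _ _))//; apply: lerD.
  rewrite cabsV cabs_nat. lra.
have Uin : cabs (half_exp u x)^-1 <= B by exact: (hB x xp).2.
pose E := (2 * L) ^+ 2 * dl ^+ 2 * B.
have E0 : 0 <= E by rewrite mulr_ge0 ?(ltW B0)// mulr_ge0// sqr_ge0.
have bump s z Y : s = 1 \/ s = -1 -> half_exp u z = Y -> 0 <= z -> z <= pi ->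
    `|x - z| <= 2 * dl ->
    cabs (s * ((half_exp u x - Y) ^+ 2 / half_exp u x)) <= E.
  move=> s1 <- z0 zp xz; rewrite cabsM (_ : cabs s = 1); last first.
    by case: s1 => ->; rewrite ?cabsN cabs1.
  rewrite mul1r cabsM; apply: ler_pM => //; rewrite ?cabs_ge0//.
  have Ldl : 0 <= 2 * L * dl by rewrite mulr_ge0 ?(ltW dl0)// mulr_ge0.
  rewrite cabsX -exprMn ler_pXn2r ?nnegrE ?cabs_ge0//.
  have h : cabs (half_exp u x - half_exp u z) <= L * `|x - z|.
    have [zx|xz'] := leP z x.
      by rewrite ger0_norm ?subr_ge0// lip.
    by rewrite cabs_distC distrC ger0_norm ?subr_ge0 ?(ltW xz')// lip// ltW.
  have h2 : L * `|x - z| <= L * (2 * dl) by rewrite ler_wpM2l.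
  by rewrite (le_trans h)// (le_trans h2)// mulrCA mulrA.
have sgn1 x0 : sgn_at x0 x = 1 \/ sgn_at x0 x = -1 :> R[i].
  by rewrite /sgn_at; case: ifP; [left|right].
have dist (x4 : R) : x1 <= x4 <= x3 -> `|x - x4| <= 2 * dl.
  move=> /andP[h1 h2]; rewrite ler_norml; move: xx3 h2; rewrite /x3 => h3 h4.
  by apply/andP; split; lra.
have [i1 [i2 i3]] : x1 <= x1 <= x3 /\ x1 <= x2 <= x3 /\ x1 <= x3 <= x3.
  by rewrite /x2 /x3; split; [|split]; apply/andP; split; lra.
have n1 := bump _ x1 t (sgn1 x1) erefl (ltW x10) (ltW x1p) (dist x1 i1).
have n2 := bump _ x2 _ (sgn1 x2) t2E (ltW (andP x2in).1) (ltW (andP x2in).2) (dist x2 i2).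
have n3 := bump _ x3 _ (sgn1 x3) t3E (ltW (andP x3in).1) (ltW (andP x3in).2) (dist x3 i3).
have rhoB2 : cabs rho ^+ 2 <= B ^+ 2.
  have h : cabs rho <= B by apply: (hB dl _).1; apply/andP; split; lra.
  by rewrite ler_pXn2r ?nnegrE ?cabs_ge0// ltW.
move: n1 n2 n3; set s1 := sgn_at x1 x; set s2 := sgn_at x2 x; set s3 := sgn_at x3 x.
set A1 := _ / half_exp u x; set A2 := (half_exp u x - t * rho) ^+ 2 / _.
set A3 := (half_exp u x - t * rho * rho) ^+ 2 / _ => n1 n2 n3.
have kapB : 8 * (B^-1 * B^-1) * (cu * dl / 2) ^+ 2 <= cabs kap.
  rewrite /kap !(cabsM _ ((rho - 1) ^+ 2)) cabsX ler_pM//.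
  - by rewrite mulr_ge0// mulr_ge0 ?invr_ge0 ?(ltW B0).
  - exact: sqr_ge0.
  - rewrite -mulrA cabsM cabs_nat ler_pM2l// (cabsM t rho) ler_pM ?(ltW B10)//; apply: inv_le => //.
      by apply: (hB x1 _).2; rewrite !ltW.
    by apply: (hB dl _).2; apply/andP; split; lra.
  - by rewrite ler_pXn2r ?nnegrE ?cabs_ge0// divr_ge0// mulr_ge0// ltW.
rewrite cabsM cabsV mulrC ler_pdivrMr ?cabs_gt0//.
have C0kap : C0 * (8 * (B^-1 * B^-1) * (cu * dl / 2) ^+ 2) <= C0 * cabs kap.
  by rewrite ler_wpM2l.
apply: le_trans C0kap.
have -> : C0 * (8 * (B^-1 * B^-1) * (cu * dl / 2) ^+ 2) = 6 * (1 + B ^+ 2) * E.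
  rewrite /C0 /E; move: (gt_eqF B0) (gt_eqF cu0) => B0' cu0'.
  by field; rewrite B0' cu0'.
have -> : 2 * s1 * rho ^+ 2 * A1 - 2 * s2 * (1 + rho ^+ 2) * A2 + 2 * s3 * A3 =
    2 * (rho ^+ 2 * (s1 * A1) - (1 + rho ^+ 2) * (s2 * A2) + s3 * A3) by ring.
rewrite cabsM cabs_nat.
have b1 : cabs (rho ^+ 2 * (s1 * A1)) <= B ^+ 2 * E.
  by rewrite cabsM cabsX ler_pM ?cabs_ge0 ?sqr_ge0.
have b2 : cabs ((1 + rho ^+ 2) * (s2 * A2)) <= (1 + B ^+ 2) * E.
  rewrite cabsM ler_pM ?cabs_ge0// (le_trans (cabsD _ _))// cabs1 cabsX.
  by rewrite lerD2l.
have := cabsB (rho ^+ 2 * (s1 * A1)) ((1 + rho ^+ 2) * (s2 * A2)).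
have := cabsD (rho ^+ 2 * (s1 * A1) - (1 + rho ^+ 2) * (s2 * A2)) (s3 * A3).
have B2E : 0 <= B ^+ 2 * E by rewrite mulr_ge0// sqr_ge0.
lra.
Qed.

End jumps.

Section completeness.
Context {R : realType}.
Variables (a : R[i]) (y : R).
Hypothesis ay : `|Cim a - y * Cre a| < 1.

Notation clos := (closed_lin_span L2 L2norm (phi a) [set n : int | n != 0]).
Notation u := (branch a true).
Notation w := (branch a false).

Let sys : system_in L2 (phi a) [set n : int | n != 0].
Proof. exact: system_in_phi. Qed.

Let i_neq0 : 'i%C != 0 :> R[i]. Proof. by rewrite -cabs_gt0 cabs_i. Qed.

Let piC_neq0 : (pi%:C : R[i]) != 0.
Proof. by rewrite -cabs_gt0 cabs_real normr_gt0 lt0r_neq0// pi_gt0. Qed.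

Let fst_only (p : R -> R[i]) := vec2 p (fun=> 0).
Let snd_only (q : R -> R[i]) := vec2 (fun=> 0) q.

Let fstB p p' x : fst_only p x - fst_only p' x = fst_only (fun x => p x - p' x) x.
Proof. by apply: vec2P; rewrite !mxE/= ?subrr. Qed.

Let L2_fst p (M : R) : cmeas p -> (forall x, 0 <= x <= pi -> cabs (p x) <= M) ->
  L2 (fst_only p).
Proof.
move=> mp hp; apply: (@L2_vec2 _ _ _ M mp (cmeas_cst 0)) => x xp.
by have h := hp x xp; rewrite cabs0; split=> //; exact: le_trans (cabs_ge0 _) h.
Qed.

Let sqnorm_fst p x : sqnormC2 (fst_only p x) = cabs (p x) ^+ 2.
Proof. by rewrite sqnormC2_vec2 cabs0 expr0n addr0. Qed.

Let sndB q q' x : snd_only q x - snd_only q' x = snd_only (fun x => q x - q' x) x.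
Proof. by apply: vec2P; rewrite !mxE/= ?subrr. Qed.

Let sqnorm_snd q x : sqnormC2 (snd_only q x) = cabs (q x) ^+ 2.
Proof. by rewrite sqnormC2_vec2 cabs0 expr0n add0r. Qed.

Let clos_fst_diff (x1 x2 : R) : 0 < x1 < pi -> 0 < x2 < pi ->
  clos (fst_only (fun x => step x1 x - step x2 x)).
Proof.
move=> h1 h2.
have := closZ sys (2 * 'i%C) (closB sys (clos_Theta_step ay h1) (clos_Theta_step ay h2)).
have st z : 0 < z < pi -> step z pi = 1 :> R[i].
  by move=> /andP[_ zp]; rewrite /step (ltW zp).
congr (clos _); apply/funext => x; apply: vec2P; rewrite !mxE/= !st//.
  by move: piC_neq0; move: (pi%:C) (x%:C) => p X p0; field; rewrite i_neq0 p0.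
by rewrite subrr mulr0.
Qed.

(* The left end of the interval tends to [0]. *)
Let clos_fst_left x2 : 0 < x2 < pi -> clos (fst_only (fun x => 1 - step x2 x)).
Proof.
move=> h2; have [x20 x2p] := andP h2.
have LT : L2 (fst_only (fun x => 1 - step x2 x)).
  apply: (@L2_fst _ 2).
    by apply: cmeasB; [exact: cmeas_cst|exact: cmeas_step].
  move=> x _; rewrite (le_trans (cabsB _ _))// cabs1 (_ : 2 = 1 + 1)//.
  by rewrite lerD2l cabs_step_le.
apply: (clos_lim_local sys (C := 1) LT) => e e0.
pose x1 := Num.min e (x2 / 2).
have x1e : x1 <= e by rewrite ge_min lexx.
have x12 : x1 <= x2 / 2 by rewrite ge_min lexx orbT.
have h1 : 0 < x1 < pi.
  by rewrite lt_min e0 divr_gt0//=; lra.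
exists (fst_only (fun x => step x1 x - step x2 x)), 0; split; first exact: clos_fst_diff.
move=> x /andP[x0 xp]; rewrite x0 add0r/= fstB sqnorm_fst.
rewrite (_ : _ - _ = 1 - step x1 x); last by ring.
rewrite /step; case: (leP x1 x) => hx; first by rewrite subrr cabs0 expr0n/=; case: ifP.
by rewrite subr0 cabs1 expr1n (le_trans (ltW hx) x1e).
Qed.

(* Its right end tends to [pi]. *)
Let clos_fst1 : clos (fst_only (fun=> 1)).
Proof.
have LT : L2 (fst_only (fun=> 1)).
  by apply: (@L2_fst _ 1) => [|x _]; [exact: cmeas_cst|rewrite cabs1].
apply: (clos_lim_local sys (C := 1) LT) => e e0; have pi0 := pi_gt0 R.
pose d := Num.min e (pi / 2).
have de : d <= e by rewrite ge_min lexx.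
have dp : d <= pi / 2 by rewrite ge_min lexx orbT.
have d0 : 0 < d by rewrite lt_min e0 divr_gt0.
have h1 : 0 < pi - d < pi by apply/andP; split; lra.
exists (fst_only (fun x => 1 - step (pi - d) x)), (pi - d).
split; first exact: clos_fst_left.
move=> x /andP[x0 xp]; rewrite fstB sqnorm_fst subKr /step.
case: (leP (pi - d) x) => hx; last by rewrite cabs0 expr0n.
by rewrite cabs1 expr1n (_ : x <= pi - d + e)//; lra.
Qed.

Lemma clos_fst f : L2 f -> clos (fst_only (fun x => f x ord0 ord0)).
Proof.
move=> Lf; have [f1 f2] := L2_component ord0 Lf.
have L1 := clos_L2 clos_fst1.
have := @clos_complex _ _ _ _ sys (fst_only (fun=> 1)) 1 (L2_mvec L1) _ clos_fst1 _ _ f1 f2.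
move=> H; rewrite (_ : fst_only _ = fun x => f x ord0 ord0 *: fst_only (fun=> 1) x); last first.
  by apply/funext => x; apply: vec2P; rewrite !mxE/= ?mulr1 ?mulr0.
apply: H => [x _|x0 x0p]; first by rewrite sqnorm_fst cabs1 expr1n.
have := closB sys clos_fst1 (clos_fst_left x0p).
congr (clos _); apply/funext => x.
apply: vec2P; rewrite !mxE/= ?mulr0 ?subrr// /step mulr1.
by rewrite subKr.
Qed.

(** * The second component *)

(** First components can now be discarded. *)
Let snd_of D q : clos (vec2 D q) -> clos (snd_only q).
Proof.
move=> h; have := closB sys h (clos_fst (clos_L2 h)).
by congr (clos _); apply/funext => x; apply: vec2P; rewrite !mxE/= ?subrr ?subr0.
Qed.

Let clos_sndD p q : clos (snd_only p) -> clos (snd_only q) ->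
  clos (snd_only (fun x => p x + q x)).
Proof.
move=> hp hq; have := closD sys hp hq; congr (clos _).
by apply/funext => x; apply: vec2P; rewrite !mxE/= ?addr0.
Qed.

Let clos_sndZ c q : clos (snd_only q) -> clos (snd_only (fun x => c * q x)).
Proof.
move=> hq; have := closZ sys c hq; congr (clos _).
by apply/funext => x; apply: vec2P; rewrite !mxE/= ?mulr0.
Qed.

Let clos_snd1 : clos (snd_only (fun=> 1)).
Proof.
have h : 0 < (pi / 2 : R) < pi by have := pi_gt0 R => p0; apply/andP; split; lra.
have := clos_sndZ (- (2 * pi%:C)) (snd_of (clos_Theta_step ay h)).
congr (clos (vec2 _ _)); apply/funext => x; rewrite /step ifT; last first.
  by case/andP: h => _ /ltW.
by move: piC_neq0; move: (pi%:C) => p p0; field; rewrite i_neq0 p0.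
Qed.

Let clos_snd_jump b x0 : 0 < x0 < pi -> clos (snd_only (jump_snd a b x0)).
Proof.
move=> x0p; have h := snd_of (clos_Theta_jump ay b x0p).
set c := _ / (2 * 'i%C * pi%:C) in h.
have := clos_sndD (clos_sndZ (- 'i%C) h) (clos_sndZ c clos_snd1).
congr (clos (vec2 _ _)); apply/funext => x.
by rewrite mulNr mulrA -expr2 sqr_i; ring.
Qed.

Let Z := half_exp w.

(** The second components of two jumps on the first branch are independent
    combinations of [Z] and [Z^-1]. *)
Let clos_half : clos (snd_only (fun x => (Z x)^-1)) /\ clos (snd_only Z).
Proof.
have pi0 := pi_gt0 R; pose x1 : R := pi / 3; pose x2 : R := x1 + x1.
have h1 : 0 < x1 < pi by apply/andP; rewrite /x1; split; lra.
have h2 : 0 < x2 < pi by apply/andP; rewrite /x2 /x1; split; lra.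
have x12 : half_exp u x2 ^+ 2 - half_exp u x1 ^+ 2 != 0.
  apply/eqP => h; have h2' : 0 <= x2 <= pi by case/andP: h2 => /ltW -> /ltW ->.
  have [] := half_sinh_eq0 (b' := true) (b := true) ay h1 h2'.
    apply: (mulIf (half_exp_neq0 u x2)); rewrite mul0r -h /half_sinh.
    by field; exact: half_exp_neq0.
  by move=> _ e; move: h1; rewrite /x2 in e; lra.
have c1 := clos_snd_jump true h1; have c2 := clos_snd_jump true h2.
have cV : clos (snd_only (fun x => (Z x)^-1)).
  have := clos_sndZ (half_exp u x2 ^+ 2 - half_exp u x1 ^+ 2)^-1
    (clos_sndD c2 (clos_sndZ (-1) c1)).
  congr (clos (vec2 _ _)); apply/funext => x; rewrite /jump_snd /half_sinh -/(Z x).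
  by field; rewrite half_exp_neq0.
split; first exact: cV.
have := clos_sndD (clos_sndZ (-1) c1) (clos_sndZ (half_exp u x1 ^+ 2) cV).
congr (clos (vec2 _ _)); apply/funext => x; rewrite /jump_snd /half_sinh -/(Z x).
by field; exact: half_exp_neq0.
Qed.

Let clos_step_sinh x0 : 0 < x0 < pi ->
  clos (snd_only (fun x => step x0 x * (Z x - Z x0 ^+ 2 / Z x))).
Proof.
move=> h; have [cV cZ] := clos_half.
have := clos_sndZ 2^-1 (clos_sndD (clos_snd_jump false h)
  (clos_sndD cZ (clos_sndZ (- Z x0 ^+ 2) cV))).
congr (clos (vec2 _ _)); apply/funext => x.
rewrite /jump_snd /half_sinh -/(Z x) -/(Z x0) sgn_atE.
by field; exact: half_exp_neq0.
Qed.

(** The function [step x0 x * (Z x - Z x0 ^+ 2 / Z x)] is continuous in [x], so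
    its difference quotient in [Z x0 ^+ 2] is bounded, and it tends to
    [- step x0 x / Z x] off [x0]. *)
Let clos_step_Z x0 : 0 < x0 < pi -> clos (snd_only (fun x => step x0 x / Z x)).
Proof.
move=> h0; have [x00 x0p] := andP h0.
have [B B1 hB] := half_exp_bounds w.
have B0 : 0 < B by exact: lt_le_trans B1.
have w0 := branch_neq0 ay false.
have [r r0 hr] := expC_lower w0.
pose cw := cabs w.
have cw0 : 0 < cw by rewrite cabs_gt0.
pose K := 2 * (cw * B ^+ 2).
have K0 : 0 <= K by rewrite mulr_ge0// mulr_ge0 ?(ltW cw0)// sqr_ge0.
(* Bound for the difference quotient between the two nodes: [K d B] bounds the
   numerator, and the denominator is bounded below by a multiple of [d]. *)
pose C0 := K * B / (B^-1 ^+ 2 * (cw / 2)).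
have C00 : 0 <= C0.
  rewrite divr_ge0// mulr_ge0 ?(ltW B0)//; first exact: sqr_ge0.
  by rewrite divr_ge0// ltW.
have mV : cmeas (fun x => (Z x)^-1).
  rewrite (_ : (fun x => _) = half_exp (- w)); last by apply/funext => x; exact: half_expV.
  exact/ccont_cmeas/ccont_half_exp.
have LT : L2 (snd_only (fun x => step x0 x / Z x)).
  apply: (@L2_vec2 _ _ _ B); first exact: cmeas_cst.
    by apply: cmeasM => //; exact: cmeas_step.
  move=> x xp; rewrite cabs0 cabsM; split; first exact: ltW.
  by rewrite -[B]mul1r ler_pM ?cabs_ge0 ?cabs_step_le// (hB x xp).2.
apply: (clos_lim_local sys (C := (B + C0) ^+ 2) LT) => e e0.
pose d := Num.min e (Num.min (r / 2) ((pi - x0) / 2)).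
have d0 : 0 < d by rewrite !lt_min e0 !divr_gt0// subr_gt0.
have de : d <= e by rewrite ge_min lexx.
have dr : d <= r / 2 by rewrite !ge_min lexx orbT.
have dp : d <= (pi - x0) / 2 by rewrite !ge_min lexx !orbT.
pose x1 := x0 + d.
have h1 : 0 < x1 < pi by apply/andP; rewrite /x1; split; lra.
pose t := Z x0 ^+ 2; pose t1 := Z x1 ^+ 2.
have tt1 : t1 - t = t * (expC (w * d%:C) - 1).
  by rewrite /t1 /t /Z half_expD exprMn (half_exp_sqr w d); ring.
have inv_le (z : R[i]) : z != 0 -> cabs z^-1 <= B -> B^-1 <= cabs z.
  by move=> z0 h; rewrite -[cabs z]invrK lef_pV2 ?posrE// -cabsV// cabs_gt0 invr_neq0.
have in0 : 0 <= x0 <= pi by rewrite !ltW.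
have lower : B^-1 ^+ 2 * (cw / 2) * d <= cabs (t1 - t).
  rewrite tt1 cabsM cabsX -mulrA; apply: ler_pM.
  - exact: sqr_ge0.
  - by rewrite mulr_ge0 ?divr_ge0// ltW.
  - rewrite ler_pXn2r ?nnegrE ?cabs_ge0 ?invr_ge0 ?(ltW B0)//; apply: inv_le.
      exact: half_exp_neq0.
    exact: (hB x0 in0).2.
  - by rewrite mulrAC; apply: hr; apply/andP; split; lra.
have lower0 : 0 < B^-1 ^+ 2 * (cw / 2).
  apply: mulr_gt0; last exact: divr_gt0.
  by rewrite exprn_gt0// invr_gt0.
have t10 : t1 - t != 0.
  by rewrite -cabs_gt0 (lt_le_trans _ lower)// mulr_gt0.
pose q x := (t1 - t)^-1 *
  (step x0 x * (Z x - t / Z x) + -1 * (step x1 x * (Z x - t1 / Z x))).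
have cq : clos (snd_only q).
  apply: clos_sndZ; apply: clos_sndD; first exact: clos_step_sinh.
  by apply: clos_sndZ; exact: clos_step_sinh.
exists (snd_only q), x0; split=> // x xp; have [xge0 xle] := andP xp.
have Z0 : Z x != 0 by exact: half_exp_neq0.
have -> : sqnormC2 (snd_only (fun x => step x0 x / Z x) x - snd_only q x) =
    cabs (step x0 x / Z x - q x) ^+ 2.
  by rewrite sndB sqnorm_snd.
have [xl|x0x] := ltP x x0.
  have s0 : step x0 x = 0 :> R[i] by rewrite /step (leNgt x0) xl.
  have s1 : step x1 x = 0 :> R[i].
    by rewrite /step (leNgt x1) (lt_le_trans xl)// lerDl ltW.
  by rewrite /q s0 s1 !mul0r mulr0 addr0 mulr0 subrr cabs0 expr0n.
have [x1x|xx1] := leP x1 x.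
  have s0 : step x0 x = 1 :> R[i] by rewrite /step x0x.
  have s1 : step x1 x = 1 :> R[i] by rewrite /step x1x.
  rewrite /q s0 s1 (_ : _ - _ = 0); last by field; rewrite Z0 t10.
  by rewrite cabs0 expr0n/=; case: ifP => // _; exact: sqr_ge0.
have -> /= : x <= x0 + e by move: xx1; rewrite /x1; lra.
have Zx : cabs (Z x)^-1 <= B by exact: (hB x xp).2.
suff hq : cabs (q x) <= C0.
  have h : cabs (step x0 x / Z x - q x) <= B + C0.
    rewrite (le_trans (cabsB _ _))// lerD// cabsM -[B]mul1r.
    by rewrite ler_pM ?cabs_ge0 ?cabs_step_le.
  by rewrite ler_pXn2r ?nnegrE ?cabs_ge0// (le_trans (cabs_ge0 _) h).
have -> : q x = (t1 - t)^-1 * ((Z x ^+ 2 - t) / Z x).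
  have s0 : step x0 x = 1 :> R[i] by rewrite /step x0x.
  have s1 : step x1 x = 0 :> R[i] by rewrite /step (leNgt x1) xx1.
  by rewrite /q s0 s1; field; rewrite t10 Z0.
have num : cabs (Z x ^+ 2 - t) <= K * d.
  rewrite /t /Z !half_exp_sqr.
  apply: (@le_trans _ _ (2 * (cw * B ^+ 2) * (x - x0))).
    apply: (cabs_increment_le x0x (cder_expC w)) => s /andP[s1 s2].
    rewrite cabsM ler_wpM2l ?cabs_ge0// -half_exp_sqr cabsX.
    rewrite ler_pXn2r ?nnegrE ?cabs_ge0 ?(ltW B0)//; apply: (hB s _).1.
    by apply/andP; split; lra.
  by rewrite -/K ler_wpM2l//; move: xx1; rewrite /x1; lra.
rewrite cabsM cabsV mulrC ler_pdivrMr ?cabs_gt0// cabsM.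
apply: (@le_trans _ _ (C0 * (B^-1 ^+ 2 * (cw / 2) * d))); last by rewrite ler_wpM2l.
rewrite (_ : C0 * _ = K * d * B); first by rewrite ler_pM ?cabs_ge0.
have lower0' := lt0r_neq0 lower0.
by rewrite /C0; move: lower0'; set k := B^-1 ^+ 2 * (cw / 2) => k0; field.
Qed.

(** The weight [Z^-1] is harmless, since [Z] is bounded and does not vanish. *)
Lemma clos_snd f : L2 f -> clos (snd_only (fun x => f x (lift ord0 ord0) ord0)).
Proof.
move=> Lf; have [B B1 hB] := half_exp_bounds w.
have B0 : 0 < B by exact: lt_le_trans B1.
have [cV _] := clos_half; have LV := clos_L2 cV.
pose g x := f x (lift ord0 ord0) ord0.
have [[m1 m2] _] := (L2E f).1 Lf.
have mg : cmeas g by split; [exact: m1|exact: m2].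
have mZ : cmeas Z by exact/ccont_cmeas/ccont_half_exp.
have LgZ : L2 (snd_only (fun x => g x * Z x)).
  have mgZ : mvec (snd_only (fun x => g x * Z x)).
    by apply: mvec_vec2; [exact: cmeas_cst|exact: cmeasM].
  have /L2E[mBf fBf] := L2Z B%:C Lf.
  apply/L2E; split=> //; apply: le_lt_trans fBf; apply: sqint_le => // x xp.
  rewrite sqnormC2_vec2 cabs0 expr0n add0r sqnormC2Z cabs_real (gtr0_norm B0).
  rewrite cabsM exprMn mulrC sqnormC2E; apply: ler_pM; rewrite ?sqr_ge0//.
    by rewrite ler_pXn2r ?nnegrE ?cabs_ge0 ?(ltW B0)// (hB x xp).1.
  by rewrite /g lerDr sqr_ge0.
have [f1 f2] := L2_component (lift ord0 ord0) LgZ.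
have := @clos_complex _ _ _ _ sys (snd_only (fun x => (Z x)^-1)) (B ^+ 2) (L2_mvec LV) _ cV _ _ f1 f2.
move=> H; rewrite (_ : snd_only _ = fun x =>
    snd_only (fun x => g x * Z x) x (lift ord0 ord0) ord0 *: snd_only (fun x => (Z x)^-1) x).
  apply: H => [x xp|x0 x0p].
    rewrite sqnormC2_vec2 cabs0 expr0n add0r ler_pXn2r ?nnegrE ?cabs_ge0 ?(ltW B0)//.
    exact: (hB x xp).2.
  have := clos_step_Z x0p; congr (clos _); apply/funext => x.
  by apply: vec2P; rewrite !mxE/= ?mulr0.
apply/funext => x; apply: vec2P; rewrite !mxE/= ?mulr0//.
by rewrite mulfK// half_exp_neq0.
Qed.

(** * The theorem *)

Lemma complete_phi : complete_system L2 L2norm (phi a) [set n : int | n != 0].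
Proof.
apply/seteqP; split => [f|f Lf]; first exact: clos_L2.
have := closD sys (clos_fst Lf) (clos_snd Lf); congr (clos _).
by apply/funext => x; apply: vec2P; rewrite !mxE/= ?addr0 ?add0r.
Qed.

End completeness.

(** If [a] is not purely imaginary the direction of [a] itself separates [u] from
    [w]; otherwise the real axis does, because [a] is between [-i] and [i]. *)
Lemma transversal_direction (R : realType) (a : R[i]) :
  ~ ([set t%:C | t in `]-oo, -1 : R] `|` `[1 : R, +oo[] ('i%C * a)) ->
  exists y, `|Cim a - y * Cre a| < 1.
Proof.
move=> ha; have [re0|re0] := eqVneq (Cre a) 0; last first.
  by exists (Cim a / Cre a); rewrite divfK// subrr normr0.
exists 0; rewrite mul0r subr0 ltNge; apply/negP => h; apply: ha.
exists (- Cim a); last by apply/eqP; rewrite eq_complex !(ReM, ImM)/= re0; apply/andP; split; apply/eqP; ring.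
move: h; rewrite ler_normr => /orP[h|h]; [left|right]; rewrite /= in_itv/= ?andbT//.
by rewrite lerN2.
Qed.

Theorem corollary4p11 (R : realType) (a : R[i])
    (ha : ~ ([set t%:C | t in `]-oo, -1 : R] `|` `[1 : R, +oo[] ('i%C * a))) :
  system_in L2 (phi a) [set n : int | n != 0] /\
  complete_system L2 L2norm (phi a) [set n : int | n != 0] /\
  minimal_system L2 L2norm (phi a) [set n : int | n != 0].
Proof.
have [y ay] := transversal_direction ha.
split; first exact: system_in_phi.
by split; [exact: complete_phi ay|exact: minimal_phi].
Qed.
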